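(* Let $X_1$ and $X_2$ be locally compact and $\sigma$-compact Hausdorff topological spaces, let $A^1=(a^1_n)_{n\in\mathbb{N}}$ be an increasing sequence of weights on $X_1$ and let $A^2=(a^2_n)_{n\in\mathbb{N}}$ be an increasing sequence of weights on $X_2$. Assume that the decreasing sequence $\mathcal{V}^2=(A^2)^{-1}=((a^2_n)^{-1})_{n\in\mathbb{N}}$ is regularly decreasing, that $C(A^1)_0(X_1)$ satisfies $(\Omega)$ and that $C(A^2)_0(X_2)$ satisfies (DN). Then the completed $\varepsilon$-tensor product $C(A^1)_0(X_1)\,\check{\otimes}_{\varepsilon}\,\mathcal{V}^2_0C(X_2)$ of a Fréchet space and a DF-space is ultrabornological.
   Context: A weight on a locally compact, $\sigma$-compact space $Y$ is a strictly positive continuous function on $Y$. A function $g:Y\to\mathbb{R}$ vanishes at infinity if for every $\varepsilon>0$ there is a compact $K\subseteq Y$ with $|g(x)|<\varepsilon$ for all $x\in Y\setminus K$. For a weight $a$ on $Y$, $C(a)_0(Y)=\{f\in C(Y): a|f|\text{ vanishes at infinity on }Y\}$, a Banach space with norm $\sup_{x\in Y}a(x)|f(x)|$, where $C(Y)$ is the space of all continuous scalar-valued functions on $Y$. A sequence $(a_n)_n$ of weights is increasing (decreasing) if $a_n\le a_{n+1}$ ($a_{n+1}\le a_n$) pointwise for all $n$. For an increasing sequence $A=(a_n)_{n}$ of weights on $Y$, $C(A)_0(Y)=\operatorname{proj}_n C(a_n)_0(Y)=\bigcap_n C(a_n)_0(Y)$ with the locally convex topology given by the norms $\|f\|_n=\sup_{x\in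 Y}a_n(x)|f(x)|$ (a Fréchet space). For a decreasing sequence $\mathcal{V}=(v_n)_n$ of weights on $Y$, $\mathcal{V}_0C(Y)=\operatorname{ind}_n C(v_n)_0(Y)=\bigcup_n C(v_n)_0(Y)$ with the locally convex inductive limit topology (an LB-space). A decreasing sequence $\mathcal{V}=(v_n)_n$ of weights on $Y$ is regularly decreasing (Bierstedt, Meise, Summers) if for every $n$ there is $m\ge n$ such that for every $\varepsilon>0$ and every $k\ge m$ there is $\delta>0$ such that, for all $x\in Y$, $v_m(x)\ge\varepsilon v_n(x)$ implies $v_k(x)\ge\delta v_n(x)$. $E\,\check{\otimes}_{\varepsilon}F$ denotes the completion of the injective ($\varepsilon$-) tensor product of the locally convex spaces $E$ and $F$. A Fréchet space $E$ with an increasing fundamental sequence of seminorms $(\|\cdot\|_n)_n$ satisfies (DN) if $$\exists n\ \forall m\ge n,\ 0<\theta<1\ \exists k\ge m,\ C>0\ \forall x\in E:\ \|x\|_m\le C\|x\|_k^{\theta}\|x\|_n^{1-\theta}.$$ It satisfies $(\Omega)$ if $$\forall N\ \exists M\ge N\ \forall K\ge M\ \exists D>0,\ 0<\theta<1\ \forall y\in E':\ \|y\|_M^{\star}\le D(\|y\|_K^{\star})^{\theta}(\|y\|_N^{\star})^{1-\theta},$$ where $\|y\|_n^{\star}=\sup_{\|x\|_n\le1}|y(x)|\in[0,\infty]$. Both conditions are independent of the choice of the fundamental sequence of seminorms. *)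

(* Defs.v *)
From HB Require Import structures.
From mathcomp Require Import all_boot all_order all_algebra.
From mathcomp Require Import complex.
From mathcomp Require Import all_classical all_reals ereal topology normedtype convex exp.
From mathcomp Require Import interval_inference ring lra.
Set Implicit Arguments.
Unset Strict Implicit.
Unset Printing Implicit Defensive.
Import Order.TTheory GRing.Theory Num.Theory.
Import numFieldNormedType.Exports.
Local Open Scope classical_set_scope.
Local Open Scope ring_scope.

(* Scalars are real or complex; every notion below is stated for both. *)
Variant scalar_kind := RealScalars | ComplexScalars.

Definition scalars (R : realType) (c : scalar_kind) : numFieldType :=
  match c with RealScalars => R | ComplexScalars => R[i] end.

Definition modulus (R : realType) (c : scalar_kind) : scalars R c -> R :=
  match c return scalars R c -> R with
  | RealScalars => fun z => `|z|
  | ComplexScalars => fun z => complex.Re `|z|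
  end.

Section Modulus.
Context {R : realType} {c : scalar_kind}.
Local Notation K := (scalars R c).
Implicit Types x y : K.

Definition real_scalar : R -> K :=
  match c return R -> scalars R c with
  | RealScalars => id
  | ComplexScalars => fun r => real_complex R r
  end.

Lemma real_modulus x : real_scalar (modulus x) = `|x|.
Proof.
rewrite /real_scalar /modulus; move: x; rewrite /scalars.
case: c => x //=; apply/RRe_real; exact: normr_real.
Qed.

Lemma ltr_real (a b : R) : (real_scalar a < real_scalar b) = (a < b).
Proof. by rewrite /real_scalar /scalars; case: c => //=; rewrite ltcR. Qed.

Lemma ler_real (a b : R) : (real_scalar a <= real_scalar b) = (a <= b).
Proof. by rewrite /real_scalar /scalars; case: c => //=; rewrite lecR. Qed.

Lemma real_scalarD (a b : R) :
  real_scalar (a + b) = real_scalar a + real_scalar b.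
Proof. by rewrite /real_scalar /scalars; case: c => //=; rewrite rmorphD. Qed.

Lemma real_scalarM (a b : R) :
  real_scalar (a * b) = real_scalar a * real_scalar b.
Proof. by rewrite /real_scalar /scalars; case: c => //=; rewrite rmorphM. Qed.

Lemma real_scalar0 : real_scalar 0 = 0.
Proof. by rewrite /real_scalar /scalars; case: c => //=; rewrite rmorph0. Qed.

Lemma real_scalar1 : real_scalar 1 = 1.
Proof. by rewrite /real_scalar /scalars; case: c => //=; rewrite rmorph1. Qed.

Lemma real_scalar_inj : injective real_scalar.
Proof. by move=> a b ab; apply/eqP; rewrite eq_le -!ler_real ab lexx. Qed.

Lemma modulus_ge0 x : 0 <= modulus x.
Proof. by rewrite -ler_real real_modulus real_scalar0. Qed.

Lemma modulus0 : modulus (0 : K) = 0.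
Proof. by apply: real_scalar_inj; rewrite real_modulus real_scalar0 normr0. Qed.

Lemma modulus1 : modulus (1 : K) = 1.
Proof. by apply: real_scalar_inj; rewrite real_modulus real_scalar1 normr1. Qed.

Lemma modulusN x : modulus (- x) = modulus x.
Proof. by apply: real_scalar_inj; rewrite !real_modulus normrN. Qed.

Lemma modulusM x y : modulus (x * y) = modulus x * modulus y.
Proof.
by apply: real_scalar_inj; rewrite real_scalarM !real_modulus normrM.
Qed.

Lemma modulusD x y : modulus (x + y) <= modulus x + modulus y.
Proof. by rewrite -ler_real real_scalarD !real_modulus ler_normD. Qed.

Lemma modulus_gt0 x : (0 < modulus x) = (x != 0).
Proof. by rewrite -ltr_real real_modulus real_scalar0 normr_gt0. Qed.

Lemma modulus_le x (r : R) : (`|x| <= real_scalar r) = (modulus x <= r).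
Proof. by rewrite -real_modulus ler_real. Qed.

Lemma modulus_lt x (r : R) : (`|x| < real_scalar r) = (modulus x < r).
Proof. by rewrite -real_modulus ltr_real. Qed.

Lemma modulus_real (r : R) : 0 <= r -> modulus (real_scalar r) = r.
Proof.
move=> r0; apply: real_scalar_inj.
by rewrite real_modulus ger0_norm// -real_scalar0 ler_real.
Qed.

Lemma modulus_dist x y : `|modulus x - modulus y| <= modulus (x - y).
Proof.
have := modulusD (x - y) y; have := modulusD (y - x) x.
rewrite !subrK -[modulus (y - x)]modulusN opprB => xy yx.
by rewrite ler_norml; apply/andP; split; lra.
Qed.
End Modulus.

Record seminorm (R : realType) (c : scalar_kind) (E : lmodType (scalars R c)) :=
  Seminorm {
    seminorm_fun :> E -> R ;
    seminormD : forall x y,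
      seminorm_fun (x + y) <= seminorm_fun x + seminorm_fun y ;
    seminormZ : forall a x, seminorm_fun (a *: x) = modulus a * seminorm_fun x
  }.

Section SeminormTheory.
Context {R : realType} {c : scalar_kind} {E : lmodType (scalars R c)}.

Lemma seminorm0 (p : seminorm E) : p 0 = 0.
Proof. by rewrite -(scale0r 0) seminormZ modulus0 mul0r. Qed.

Lemma seminormN (p : seminorm E) x : p (- x) = p x.
Proof. by rewrite -scaleN1r seminormZ modulusN modulus1 mul1r. Qed.

Lemma seminorm_ge0 (p : seminorm E) x : 0 <= p x.
Proof.
have := seminormD p x (- x); rewrite subrr seminorm0 seminormN -mulr2n.
by rewrite pmulrn_lge0.
Qed.

Context {I : Type} (p : I -> seminorm E).

Definition seminorm_sum (s : seq I) (x : E) : R := \sum_(i <- s) p i x.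

Lemma seminorm_sumD s x y :
  seminorm_sum s (x + y) <= seminorm_sum s x + seminorm_sum s y.
Proof.
by rewrite -big_split; apply: ler_sum => i _; exact: seminormD.
Qed.

Lemma seminorm_sumZ s a x :
  seminorm_sum s (a *: x) = modulus a * seminorm_sum s x.
Proof. by rewrite mulr_sumr; apply: eq_bigr => i _; rewrite seminormZ. Qed.

Lemma seminorm_sum0 s : seminorm_sum s 0 = 0.
Proof. by rewrite /seminorm_sum big1// => i _; rewrite seminorm0. Qed.

Lemma seminorm_sumN s x : seminorm_sum s (- x) = seminorm_sum s x.
Proof. by apply: eq_bigr => i _; rewrite seminormN. Qed.

Lemma seminorm_sum_ge0 s x : 0 <= seminorm_sum s x.
Proof. by apply: sumr_ge0 => i _; exact: seminorm_ge0. Qed.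

Lemma seminorm_sum_cat s t x :
  seminorm_sum (s ++ t) x = seminorm_sum s x + seminorm_sum t x.
Proof. by rewrite /seminorm_sum big_cat. Qed.

End SeminormTheory.

(* The space E with the locally convex topology generated by the seminorms
   p i, whose balls are those of the finite sums of the p i. *)
Definition seminormed (R : realType) (c : scalar_kind)
  (E : lmodType (scalars R c)) (I : Type) (p : I -> seminorm E) : Type := E.

Section SeminormedTopology.
Context (R : realType) (c : scalar_kind).
Local Notation K := (scalars R c).
Context (E : lmodType K) (I : Type) (p : I -> seminorm E).
Local Notation T := (seminormed p).

HB.instance Definition _ := GRing.Lmodule.copy T E.

Definition seminormed_ball (s : seq I) (e : R) (x : T) : set T :=
  [set y | seminorm_sum p s (y - x) < e].

Definition seminormed_nbhs (x : T) : set_system T :=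
  [set U | exists s, exists2 e, 0 < e & seminormed_ball s e x `<=` U].

HB.instance Definition _ := hasNbhs.Build T seminormed_nbhs.

Let ball_center s e x : 0 < e -> seminormed_ball s e x x.
Proof. by rewrite /seminormed_ball/= subrr seminorm_sum0. Qed.

Let ball_triangle s e x y : seminormed_ball s e x y ->
  exists2 d, 0 < d & seminormed_ball s d y `<=` seminormed_ball s e x.
Proof.
rewrite /seminormed_ball/= => xy; exists (e - seminorm_sum p s (y - x)).
  by rewrite subr_gt0.
move=> z /= yz; rewrite -(subrK y z) -addrA.
by apply: le_lt_trans (seminorm_sumD _ _ _ _) _; rewrite -ltrBrDr.
Qed.

Let nbhs_pfilter (x : T) : ProperFilter (nbhs x).
Proof.
split; first by move=> [s [e e0]]; apply; exact: ball_center.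
split.
- by exists [::], 1.
- move=> U V [s [d d0 sU]] [t [e e0 tV]].
  exists (s ++ t), (Num.min d e); first by rewrite lt_min d0 e0.
  move=> y; rewrite /seminormed_ball/= seminorm_sum_cat lt_min => /andP[yd ye].
  split.
    by apply/sU/(le_lt_trans _ yd); rewrite lerDl seminorm_sum_ge0.
  by apply/tV/(le_lt_trans _ ye); rewrite lerDr seminorm_sum_ge0.
- by move=> U V UV [s [e e0 sU]]; exists s, e => // y /sU/UV.
Qed.

Let nbhs_single (x : T) (U : set T) : nbhs x U -> U x.
Proof. by move=> [s [e e0]]; apply; exact: ball_center. Qed.

Let nbhs_twice (x : T) (U : set T) : nbhs x U -> nbhs x (nbhs^~ U).
Proof.
move=> [s [e e0 sU]]; exists s, e => // y /ball_triangle[d d0 yx].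
by exists s, d => // z /yx/sU.
Qed.

HB.instance Definition _ :=
  Nbhs_isNbhsTopological.Build T nbhs_pfilter nbhs_single nbhs_twice.

Let add_continuous : continuous (fun x : T * T => x.1 + x.2).
Proof.
move=> [x y] U [s [e e0 sU]] /=.
exists (seminormed_ball s (e / 2) x, seminormed_ball s (e / 2) y).
  by split; exists s, (e / 2); rewrite ?divr_gt0.
move=> [x' y'] [/= xx' yy']; apply: sU => /=; rewrite /seminormed_ball/=.
rewrite opprD addrACA (le_lt_trans (seminorm_sumD _ _ _ _))//.
by rewrite (splitr e) ltrD.
Qed.

Let scale_continuous : continuous (fun z : K^o * T => z.1 *: z.2).
Proof.
move=> [k x] U [s [e e0 sU]] /=.
set q := seminorm_sum p s.
pose d := Num.min 1 (e / 2 / (q x + 1)).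
pose d' := e / 2 / (modulus k + 1).
have qx : 0 < q x + 1 by rewrite ltr_wpDl// seminorm_sum_ge0.
have mk : 0 < modulus k + 1 by rewrite ltr_wpDl// modulus_ge0.
have d0 : 0 < d by rewrite lt_min ltr01 !divr_gt0.
have d'0 : 0 < d' by rewrite !divr_gt0.
exists (ball (k : K^o) (real_scalar d), seminormed_ball s d' x).
  split; last by exists s, d'.
  by apply: nbhsx_ballx; rewrite -real_scalar0 ltr_real.
move=> [l y] [/=]; rewrite -ball_normE/= modulus_lt => kl xy.
apply: sU; rewrite /seminormed_ball/= -/q.
have -> : l *: y - k *: x = l *: (y - x) + (l - k) *: x :> T.
  by rewrite scalerBr scalerBl addrA subrK.
rewrite (le_lt_trans (seminorm_sumD _ _ _ _))// !seminorm_sumZ -/q.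
have {kl} kl : modulus (l - k) < d by rewrite -modulusN opprB.
have lk : modulus l <= modulus k + 1.
  have := modulusD (l - k) k; rewrite subrK => /le_trans; apply.
  by rewrite addrC lerD2l ltW// (lt_le_trans kl)// ge_min lexx.
rewrite (splitr e) ltr_leD//.
  rewrite (@le_lt_trans _ _ ((modulus k + 1) * q (y - x)))//.
    by rewrite ler_wpM2r// seminorm_sum_ge0.
  by rewrite -ltr_pdivlMl// mulrC.
rewrite (@le_trans _ _ (modulus (l - k) * (q x + 1)))//.
  by rewrite ler_wpM2l ?modulus_ge0// lerDl.
by rewrite -ler_pdivlMr// ltW// (lt_le_trans kl)// ge_min lexx orbT.
Qed.

Let locally_convex : exists2 B : set_system T,
  (forall b, b \in B -> convex_set b) & basis B.
Proof.
exists [set b | exists s, exists e, exists x, b = seminormed_ball s e x].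
  move=> b /[!inE] -[s [e [x ->]]] y z l /[!inE]; rewrite /seminormed_ball/=.
  set q := seminorm_sum p s => xy xz.
  have -> : conv l (y : convex_lmodType T) z - x =
      l%:num *: (y - x) + (1 - l%:num) *: (z - x) :> T.
    rewrite !scalerBr addrACA -opprD -scalerDl (addrC _ (1 - _)) subrK scale1r.
    by [].
  rewrite (le_lt_trans (seminorm_sumD _ _ _ _))// !seminorm_sumZ -/q.
  have ml : modulus (l%:num : scalars R c) + modulus ((1 - l%:num) : scalars R c) = 1.
    apply: (@real_scalar_inj R c).
    rewrite real_scalarD real_scalar1 !real_modulus ger0_norm//.
    by rewrite ger0_norm ?subr_ge0// addrC subrK.
  have := modulus_ge0 (l%:num : scalars R c).
  have := modulus_ge0 ((1 - l%:num) : scalars R c).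
  move: ml xy xz; set u := modulus _; set v := modulus _ => uv xy xz v0 u0.
  have [u1|u1] := eqVneq u 0.
    by rewrite u1 mul0r add0r; move: uv; rewrite u1 add0r => ->; rewrite mul1r.
  have -> : e = u * e + v * e by rewrite -mulrDl uv mul1r.
  apply: ltr_leD; last by rewrite ler_wpM2l// ltW.
  by rewrite ltr_pM2l// lt_neqAle eq_sym u1.
split.
  move=> _ [s [e [x ->]]]; rewrite openE => y /ball_triangle[d d0 yx].
  by exists s, d.
move=> x U [s [e e0 sU]]; exists (seminormed_ball s e x) => //.
by split; [exists s, e, x|exact: ball_center].
Qed.

HB.instance Definition _ := PreTopologicalLmod_isTvs.Build K T
  add_continuous scale_continuous locally_convex.
HB.instance Definition _ :=
  PreTopologicalNmodule_isTopologicalNmodule.Build T add_continuous.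
HB.instance Definition _ :=
  TopologicalNmodule_isTopologicalLmodule.Build K T scale_continuous.
HB.instance Definition _ := Uniform_isTvs.Build K T locally_convex.

End SeminormedTopology.

(* Linear subspaces given by a Prop-valued set, and the type of their
   elements as a left module. *)
Record linsub (K : numFieldType) (V : lmodType K) := Linsub {
  linsub_set :> set V ;
  linsub0 : linsub_set 0 ;
  linsubP : forall a x y, linsub_set x -> linsub_set y -> linsub_set (a *: x + y)
}.

Record linsub_type (K : numFieldType) (V : lmodType K) (S : linsub V) :=
  LinsubType { linsub_val :> V ; linsub_valP : linsub_val \in linsub_set S }.

Section LinsubInstances.
Context (K : numFieldType) (V : lmodType K) (S : linsub V).

HB.instance Definition _ := [isSub for @linsub_val K V S].
HB.instance Definition _ := [Choice of linsub_type S by <:].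

Let linsub_closed : GRing.subsemimod_closed (mem (linsub_set S)).
Proof.
split; [split|].
- by rewrite inE; exact: linsub0.
- by move=> x y /[!inE] Sx Sy; rewrite -(scale1r x); exact: linsubP.
- move=> a x /[!inE] Sx; rewrite -(addr0 (a *: x)); apply: linsubP => //.
  exact: linsub0.
Qed.

HB.instance Definition _ :=
  GRing.SubChoice_isSubLmodule.Build K V _ (linsub_type S) linsub_closed.
End LinsubInstances.

Definition linsub_elt (K : numFieldType) (V : lmodType K) (S : linsub V) (x : V)
  (Sx : linsub_set S x) : linsub_type S := LinsubType (mem_set Sx).

Lemma linsub_in (K : numFieldType) (V : lmodType K) (S : linsub V)
  (x : linsub_type S) : linsub_set S x.
Proof. by have := linsub_valP x; rewrite inE. Qed.

Section LinsubIncl.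
Context (K : numFieldType) (V : lmodType K) (S S' : linsub V).
Variable SS' : linsub_set S `<=` linsub_set S'.

Definition linsub_incl (x : linsub_type S) : linsub_type S' :=
  linsub_elt (SS' (linsub_in x)).

Let linsub_incl_linear : linear linsub_incl.
Proof. by move=> a x y; apply: val_inj. Qed.

HB.instance Definition _ :=
  GRing.isLinear.Build K (linsub_type S) (linsub_type S') _ linsub_incl
    linsub_incl_linear.
End LinsubIncl.

Section WeightedSup.
Context {R : realType} {c : scalar_kind} {T : Type} (D : set T) (w : T -> R).
Local Notation K := (scalars R c).
Implicit Types f g : T -> K^o.
Hypothesis w0 : forall t, 0 <= w t.

Definition weighted_sup f : R := sup [set w t * modulus (f t) | t in D].

Let bounded f := has_ubound [set w t * modulus (f t) | t in D].

Lemma weighted_sup_ub f t : bounded f -> D t ->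
  w t * modulus (f t) <= weighted_sup f.
Proof. by move=> bf Dt; apply: ub_le_sup => //; exists t. Qed.

Lemma weighted_sup_le f (M : R) : 0 <= M ->
  (forall t, D t -> w t * modulus (f t) <= M) -> weighted_sup f <= M.
Proof.
move=> M0 fM; rewrite /weighted_sup.
have [[t Dt]|/nonemptyPn ->] := pselect (D !=set0).
  by apply: ge_sup => [|_ [s Ds <-]]; [exists (w t * modulus (f t)), t|exact: fM].
by rewrite image_set0 sup0.
Qed.

Lemma weighted_sup_ge0 f : bounded f -> 0 <= weighted_sup f.
Proof.
move=> bf; have [[t Dt]|/nonemptyPn D0] := pselect (D !=set0).
  by apply: le_trans (weighted_sup_ub bf Dt); rewrite mulr_ge0 ?modulus_ge0.
by rewrite /weighted_sup D0 image_set0 sup0.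
Qed.

Lemma weighted_supD f g : bounded f -> bounded g ->
  weighted_sup (f + g) <= weighted_sup f + weighted_sup g.
Proof.
move=> bf bg; apply: weighted_sup_le => [|t Dt].
  by rewrite addr_ge0// weighted_sup_ge0.
apply: le_trans (lerD (weighted_sup_ub bf Dt) (weighted_sup_ub bg Dt)).
by rewrite -mulrDr ler_wpM2l// modulusD.
Qed.

Let weighted_supZ_le b f : bounded f ->
  weighted_sup (b *: f) <= modulus b * weighted_sup f.
Proof.
move=> bf; apply: weighted_sup_le => [|t Dt].
  by rewrite mulr_ge0 ?modulus_ge0// weighted_sup_ge0.
rewrite [modulus _](modulusM b (f t)) mulrCA ler_wpM2l ?modulus_ge0//.
exact: weighted_sup_ub.
Qed.

Let boundedZ b f : bounded f -> bounded (b *: f).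
Proof.
move=> [M fM]; exists (modulus b * M) => _ [t Dt <-].
rewrite [modulus _](modulusM b (f t)) mulrCA ler_wpM2l ?modulus_ge0//.
by apply: fM; exists t.
Qed.

Lemma weighted_supZ b f : bounded f ->
  weighted_sup (b *: f) = modulus b * weighted_sup f.
Proof.
move=> bf; apply/eqP; rewrite eq_le weighted_supZ_le//=.
have [->|b0] := eqVneq b 0.
  by rewrite modulus0 mul0r weighted_sup_ge0//; exact: boundedZ.
have mb : 0 < modulus b by rewrite modulus_gt0.
rewrite -ler_pdivlMl//.
have /(weighted_supZ_le b^-1) : bounded (b *: f) by exact: boundedZ.
rewrite scalerA mulVf// scale1r => /le_trans; apply.
rewrite ler_wpM2r//; first by rewrite weighted_sup_ge0//; exact: boundedZ.
rewrite -(ler_pM2l mb) -modulusM mulfV//.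
by rewrite modulus1 mulfV// gt_eqF.
Qed.

End WeightedSup.

(* The finest locally convex topology on E for which all the maps iota n are
   continuous: it is generated by all the seminorms p on E such that every
   p \o iota n is continuous. *)
Definition inductive_limit (R : realType) (c : scalar_kind)
    (E_ : nat -> tvsType (scalars R c)) (E : lmodType (scalars R c))
    (iota : forall n, {linear E_ n -> E}) : tvsType (scalars R c) :=
  @seminormed R c E {p : seminorm E | forall n, continuous (p \o iota n)}
    (fun p => sval p).

Definition sigma_compact (Y : topologicalType) :=
  exists2 L : nat -> set Y, (forall n, compact (L n)) & \bigcup_n L n = setT.

Definition vanishes_at_infinity (R : realType) (Y : topologicalType)
    (g : Y -> R) :=
  forall e, 0 < e ->
    exists2 L : set Y, compact L & forall x, ~ L x -> `|g x| < e.

Record weight (R : realType) (Y : topologicalType) := Weight {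
  weight_fun :> Y -> R ;
  weight_gt0 : forall x, 0 < weight_fun x ;
  weight_continuous : continuous weight_fun
}.

Section Inverse.
Context {R : realType} {Y : topologicalType}.
Program Definition inverse_weight (a : weight R Y) : weight R Y :=
  @Weight R Y (fun x => (a x)^-1) _ _.
Next Obligation. by move=> a x /=; rewrite invr_gt0 weight_gt0. Qed.
Next Obligation.
move=> a x /=; apply: cvgV; last exact: weight_continuous.
by rewrite gt_eqF// weight_gt0.
Qed.
End Inverse.

Record increasing_weights (R : realType) (Y : topologicalType) := IncWeights {
  inc_weight :> nat -> weight R Y ;
  inc_weightP : forall n x, inc_weight n x <= inc_weight n.+1 x
}.

Record decreasing_weights (R : realType) (Y : topologicalType) := DecWeights {
  dec_weight :> nat -> weight R Y ;
  dec_weightP : forall n x, dec_weight n.+1 x <= dec_weight n x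
}.

Program Definition inverse_weights (R : realType) (Y : topologicalType)
    (a : increasing_weights R Y) : decreasing_weights R Y :=
  @DecWeights R Y (fun n => inverse_weight (a n)) _.
Next Obligation.
by move=> R Y a n x /=; rewrite lef_pV2 ?posrE ?weight_gt0// inc_weightP.
Qed.

Definition regularly_decreasing (R : realType) (Y : topologicalType)
    (v : decreasing_weights R Y) :=
  forall n, exists2 m, (n <= m)%N &
    forall e k, 0 < e -> (m <= k)%N ->
      exists2 d, 0 < d &
        forall x, e * v n x <= v m x -> d * v n x <= v k x.

Section WeightedSpaces.
Context (R : realType) (c : scalar_kind) (Y : topologicalType).
Local Notation K := (scalars R c).

Lemma modulus_continuous : continuous (@modulus R c : K^o -> R).
Proof.
move=> x U /nbhs_ballP[e /= e0 eU]; apply/nbhs_ballP.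
exists (real_scalar e) => /=; first by rewrite -real_scalar0 ltr_real.
move=> y; rewrite -ball_normE/= modulus_lt => xy; apply: eU.
by rewrite -ball_normE/=; apply: le_lt_trans xy; exact: modulus_dist.
Qed.

Context (J : Type) (a : J -> weight R Y).

(* For a family a of weights, C0 a is the intersection over j of the spaces
   C(a_j)_0(Y), with the topology of the norms ||f||_j. A family indexed by
   unit gives the space C(a)_0(Y) of a single weight; an increasing sequence
   A = (a_n)_n gives the projective limit C(A)_0(Y). *)
Definition C0_set : set (Y -> K^o) :=
  [set f | continuous f /\
    forall j, vanishes_at_infinity (fun x => a j x * modulus (f x))].

Definition C0_norm (j : J) (f : Y -> K^o) : R :=
  weighted_sup [set: Y] (a j) f.

Lemma C0_bounded j f : C0_set f ->
  has_ubound [set a j x * modulus (f x) | x in [set: Y]].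
Proof.
move=> [fc /(_ j 1 ltr01)[L Lc Lf]].
pose g x := a j x * modulus (f x).
have gc : continuous g.
  move=> x; apply: cvgM; first exact: weight_continuous.
  by apply: continuous_comp; [exact: fc|exact: modulus_continuous].
have : compact (g @` L).
  by apply: continuous_compact => //; exact: continuous_subspaceT.
move=> /compact_bounded[M [Mr /(_ (`|M| + 1))]].
rewrite ltr_pwDr// ?ler_norm// => /(_ isT) ML.
exists (`|M| + 1) => _ [x _ <-]; have [Lx|nLx] := pselect (L x).
  by apply: (le_trans (ler_norm _)); apply: ML; exists x.
apply: (le_trans (ler_norm _)); rewrite (le_trans (ltW (Lf _ nLx)))//.
by rewrite lerDr.
Qed.

Lemma C0_closed b f g : C0_set f -> C0_set g -> C0_set (b *: f + g).
Proof.
move=> [fc f0] [gc g0]; split.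
  move=> x; apply: (@cvgD K K^o _ (nbhs x)); last exact: gc.
  by apply: (@cvgZr _ K^o); exact: fc.
move=> j e e0.
have mb : 0 < modulus b + 1 by rewrite ltr_wpDl// modulus_ge0.
have [|L Lc Lf] := f0 j (e / 2 / (modulus b + 1)); first by rewrite !divr_gt0.
have [|M Mc Mg] := g0 j (e / 2); first by rewrite divr_gt0.
exists (L `|` M); first exact: compactU.
move=> x /not_orP[/Lf fx /Mg gx].
move: fx gx; rewrite !ger0_norm ?mulr_ge0 ?modulus_ge0 ?(ltW (weight_gt0 _ _))//.
move=> fx gx; rewrite (@le_lt_trans _ _
  (modulus b * (a j x * modulus (f x)) + a j x * modulus (g x)))//.
  rewrite mulrCA -mulrDr -modulusM ler_pM2l ?weight_gt0//.
  exact: modulusD.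
rewrite (splitr e) ler_ltD//.
rewrite (@le_trans _ _ ((modulus b + 1) * (a j x * modulus (f x))))//.
  by rewrite ler_wpM2r ?lerDl// mulr_ge0 ?modulus_ge0// ltW// weight_gt0.
by rewrite -ler_pdivlMl// [leRHS]mulrC ltW.
Qed.

Lemma C0_zero : C0_set 0.
Proof.
split; first by move=> x; exact: cvg_cst.
move=> j e e0; exists set0; first exact: compact0.
by move=> x _ /=; rewrite modulus0 mulr0 normr0.
Qed.

Definition C0_linsub := Linsub C0_zero C0_closed.

Let weight_ge0 j x : 0 <= a j x. Proof. exact/ltW/weight_gt0. Qed.

Lemma C0_normD j (f g : linsub_type C0_linsub) :
  C0_norm j (val (f + g)) <= C0_norm j (val f) + C0_norm j (val g).
Proof.
exact: (weighted_supD (@weight_ge0 j) (C0_bounded j (linsub_in f))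
  (C0_bounded j (linsub_in g))).
Qed.

Lemma C0_normZ j b (f : linsub_type C0_linsub) :
  C0_norm j (val (b *: f)) = modulus b * C0_norm j (val f).
Proof.
exact: (weighted_supZ (@weight_ge0 j) b (C0_bounded j (linsub_in f))).
Qed.

Definition C0_seminorm (j : J) : seminorm (linsub_type C0_linsub) :=
  @Seminorm R c (linsub_type C0_linsub) (fun f => C0_norm j (val f)) (C0_normD j) (C0_normZ j).

Definition C0 : tvsType K := seminormed C0_seminorm.

Definition C0_norms (j : J) (f : C0) : R := C0_norm j (linsub_val f).

End WeightedSpaces.

Section InductiveWeightedSpace.
Context (R : realType) (c : scalar_kind) (Y : topologicalType).
Local Notation K := (scalars R c).
Context (v : decreasing_weights R Y).

Let step n : unit -> weight R Y := fun=> v n.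

(* The (LB)-space V_0C(Y), the union over n of the C(v_n)_0(Y). *)
Definition V0C_set : set (Y -> K^o) := [set f | exists n, C0_set (step n) f].

Lemma C0_set_step_incl n m : (n <= m)%N ->
  @C0_set R c Y _ (step n) `<=` C0_set (step m).
Proof.
move=> nm f [fc f0]; split=> // -[] e e0.
have [L Lc Lf] := f0 tt e e0; exists L => // x /Lf.
apply: le_lt_trans; rewrite /step !normrM ler_wpM2r//.
rewrite !gtr0_norm ?weight_gt0//.
move: nm; elim: m => [|m IH]; first by rewrite leqn0 => /eqP ->.
rewrite leq_eqVlt => /predU1P[->//|/IH]; apply: le_trans.
exact: dec_weightP.
Qed.

Lemma V0C_zero : V0C_set 0.
Proof. by exists 0%N; exact: C0_zero. Qed.

Lemma V0C_closed b f g : V0C_set f -> V0C_set g -> V0C_set (b *: f + g).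
Proof.
move=> [n nf] [m mg]; exists (maxn n m); apply: C0_closed.
  exact: (C0_set_step_incl (leq_maxl n m)).
exact: (C0_set_step_incl (leq_maxr n m)).
Qed.

Definition V0C_linsub := Linsub V0C_zero V0C_closed.

Lemma C0_sub_V0C n :
  linsub_set (C0_linsub c (step n)) `<=` linsub_set V0C_linsub.
Proof. by move=> f fn; exists n. Qed.

Definition V0C_incl n : {linear C0 c (step n) -> linsub_type V0C_linsub} :=
  linsub_incl (@C0_sub_V0C n).

Definition V0C : tvsType K := inductive_limit V0C_incl.

End InductiveWeightedSpace.

(* (DN) and (Omega) for a space with the fundamental sequence of seminorms
   p. *)
Definition cond_DN (R : realType) (c : scalar_kind)
    (E : tvsType (scalars R c)) (p : nat -> E -> R) :=
  exists n, forall m theta, (n <= m)%N -> 0 < theta < 1 ->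
    exists k C, [/\ (m <= k)%N, 0 < C &
      forall x, p m x <= C * (p k x `^ theta) * (p n x `^ (1 - theta))].

Record dual (R : realType) (c : scalar_kind) (E : tvsType (scalars R c)) :=
  Dual {
    dual_fun :> {linear E -> (scalars R c)^o} ;
    dual_continuous : continuous dual_fun
  }.

Definition dual_norm (R : realType) (c : scalar_kind)
    (E : tvsType (scalars R c)) (p : E -> R) (y : dual E) : \bar R :=
  ereal_sup [set (modulus (y x))%:E | x in [set x | p x <= 1]].

Definition cond_Omega (R : realType) (c : scalar_kind)
    (E : tvsType (scalars R c)) (p : nat -> E -> R) :=
  forall N, exists2 M, (N <= M)%N & forall K, (M <= K)%N ->
    exists D theta, [/\ 0 < D, 0 < theta < 1 &
      forall y : dual E,
        (dual_norm (p M) y <= D%:E * (dual_norm (p K) y `^ theta) *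
                              (dual_norm (p N) y `^ (1 - theta)))%E].

Section InjectiveTensor.
Context (R : realType) (c : scalar_kind).
Local Notation K := (scalars R c).
Context (E F : tvsType K).

Definition polar (G : tvsType K) (U : set G) : set (dual G) :=
  [set phi | forall x, U x -> modulus (phi x) <= 1].

(* A tensor sum_i x_i (x) y_i is represented by the bilinear form
   (phi, psi) |-> sum_i phi(x_i) psi(y_i) on E' x F'. For Hausdorff locally
   convex E and F the duals separate points, so that this is a faithful
   representation of the algebraic tensor product. *)
Definition tensor_sum (s : seq (E * F)) : dual E * dual F -> K^o :=
  fun phi => \sum_(t <- s) phi.1 t.1 * phi.2 t.2.

Definition tensor_set : set (dual E * dual F -> K^o) :=
  [set tensor_sum s | s in setT].

Lemma tensor_zero : tensor_set 0.
Proof. by exists [::] => //; apply/funext => phi; rewrite /tensor_sum big_nil. Qed.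

Lemma tensor_closed a u v :
  tensor_set u -> tensor_set v -> tensor_set (a *: u + v).
Proof.
move=> [s _ <-] [t _ <-]; exists ([seq (a *: x.1, x.2) | x <- s] ++ t) => //.
apply/funext => phi; rewrite /tensor_sum big_cat big_map; congr (_ + _).
rewrite [RHS]mulr_sumr; apply: eq_bigr => x _ /=.
by rewrite linearZ/= mulrA.
Qed.

Definition tensor_linsub := Linsub tensor_zero tensor_closed.

(* The injective topology is that of uniform convergence on the products of
   equicontinuous sets, i.e. on the products of polars of neighbourhoods of
   0. *)
Definition eps_norm (U : set E) (V : set F) : (dual E * dual F -> K^o) -> R :=
  weighted_sup (polar U `*` polar V) (fun=> 1).

Lemma polar_bounded (G : tvsType K) (U : set G) x : nbhs 0 U ->
  exists2 M, 0 <= M & forall phi, polar U phi -> modulus (phi x) <= M.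
Proof.
move=> U0.
have /= := @scale_continuous K G (0, x) U; rewrite scale0r => /(_ U0).
move=> [[A B] [/= A0 B0] AB].
have [e e0 eA] : exists2 e : R, 0 < e & A (real_scalar e).
  move: A0 => /nbhs_ballP[d /= d0 dA]; exists (modulus d / 2).
    by rewrite divr_gt0// modulus_gt0 gt_eqF.
  have dE : d = real_scalar (modulus d) by rewrite real_modulus gtr0_norm.
  apply: dA; rewrite -ball_normE/= sub0r normrN {2}dE modulus_lt.
  rewrite modulus_real ?divr_ge0 ?modulus_ge0// ltr_pdivrMr//.
  by rewrite ltr_pMr ?ltr1n// modulus_gt0 gt_eqF.
exists (e^-1) => [|phi Uphi]; first by rewrite invr_ge0 ltW.
have : modulus (phi (real_scalar e *: x)) <= 1.
  apply: Uphi; apply: (AB (real_scalar e, x)); split => //.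
  exact: nbhs_singleton.
rewrite linearZ /= [modulus _]modulusM (modulus_real (ltW e0)).
by rewrite -ler_pdivlMl// mulr1.
Qed.

Lemma eps_bounded U V u :
  tensor_set u -> nbhs 0 U -> nbhs 0 V ->
  has_ubound [set 1 * modulus (u phi) | phi in polar U `*` polar V].
Proof.
move=> [s _ <-] U0 V0.
elim: s => [|[x y] s [M sM]].
  exists 0 => _ [phi _ <-].
  by rewrite /tensor_sum big_nil modulus0 mulr0.
have [B B0 xB] := polar_bounded x U0.
have [C C0 yC] := polar_bounded y V0.
exists (B * C + M) => _ [[phi psi] [/= Uphi Vpsi] <-].
rewrite mul1r /tensor_sum big_cons (le_trans (modulusD _ _))//= lerD//.
  by rewrite modulusM ler_pM ?modulus_ge0 ?xB ?yC.
by rewrite -[leLHS]mul1r; apply: sM; exists (phi, psi).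
Qed.

Section EpsSeminorm.
Variables (U : set E) (V : set F).
Hypotheses (U0 : nbhs 0 U) (V0 : nbhs 0 V).

Lemma eps_normD (u v : linsub_type tensor_linsub) :
  eps_norm U V (val (u + v)) <= eps_norm U V (val u) + eps_norm U V (val v).
Proof.
exact: (weighted_supD (fun=> ler01) (eps_bounded (linsub_in u) U0 V0)
  (eps_bounded (linsub_in v) U0 V0)).
Qed.

Lemma eps_normZ a (u : linsub_type tensor_linsub) :
  eps_norm U V (val (a *: u)) = modulus a * eps_norm U V (val u).
Proof.
exact: (weighted_supZ (fun=> ler01) a (eps_bounded (linsub_in u) U0 V0)).
Qed.

Definition eps_seminorm : seminorm (linsub_type tensor_linsub) :=
  @Seminorm R c (linsub_type tensor_linsub) (fun u => eps_norm U V (val u))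
    eps_normD eps_normZ.
End EpsSeminorm.

Definition injective_tensor : tvsType K :=
  @seminormed R c (linsub_type tensor_linsub)
    ({U : set E | nbhs 0 U} * {V : set F | nbhs 0 V})
    (fun UV => eps_seminorm (svalP UV.1) (svalP UV.2)).

End InjectiveTensor.

Section Completion.
Context (R : realType) (c : scalar_kind).
Local Notation K := (scalars R c).

(* Cauchy filters are those of the additive uniformity: the uniform structure
   carried by an abstract tvsType is only required to induce the topology, so
   the library's cauchy cannot be used here. *)
Definition tvs_cauchy (G : tvsType K) (F : set_system G) :=
  forall U, nbhs (0 : G) U ->
    exists2 A, F A & forall x y, A x -> A y -> U (x - y).

Definition tvs_complete (G : tvsType K) :=
  forall F : set_system G, ProperFilter F -> tvs_cauchy F ->
    exists x : G, F --> x.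

(* j : H -> G realizes G as the (Hausdorff) completion of H. It is determined
   up to a unique topological isomorphism over H. *)
Record is_completion (H G : tvsType K) (j : {linear H -> G}) : Prop := {
  completion_hausdorff : hausdorff_space G ;
  completion_complete : tvs_complete G ;
  completion_inj : injective j ;
  completion_nbhs : forall W : set H,
    nbhs 0 W <-> exists2 U, nbhs (0 : G) U & j @^-1` U `<=` W ;
  completion_dense : dense (range j)
}.

Definition absolutely_convex (E : lmodType K) (B : set E) :=
  B 0 /\ forall (a b : K) x y, modulus a + modulus b <= 1 ->
    B x -> B y -> B (a *: x + b *: y).

Definition absorbs (E : lmodType K) (A B : set E) :=
  exists2 r : R, 0 < r & forall a : K, r <= modulus a ->
    B `<=` [set a *: x | x in A].

Definition tvs_bounded (E : tvsType K) (B : set E) :=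
  forall U, nbhs (0 : E) U -> absorbs U B.

Definition gauge_domain (E : lmodType K) (B : set E) (x : E) : set R :=
  [set t | 0 < t /\ [set real_scalar t *: y | y in B] x].

Definition gauge (E : lmodType K) (B : set E) (x : E) : R :=
  inf (gauge_domain B x).

(* disc_span B is the linear span E_B of an absolutely convex set B; a Banach
   disc is a bounded one for which E_B with the gauge of B is complete. *)
Definition disc_span (E : lmodType K) (B : set E) : set E :=
  [set x | gauge_domain B x !=set0].

Definition banach_disc (E : tvsType K) (B : set E) :=
  [/\ absolutely_convex B, tvs_bounded B &
    forall u : nat -> E, (forall n, disc_span B (u n)) ->
      (forall e, 0 < e -> exists N, forall m n, (N <= m)%N -> (N <= n)%N ->
         gauge B (u m - u n) < e) ->
      exists2 x, disc_span B x &
        forall e, 0 < e -> exists N, forall n, (N <= n)%N ->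
          gauge B (u n - x) < e].

Definition ultrabornological (E : tvsType K) :=
  forall A : set E, absolutely_convex A ->
    (forall B, banach_disc B -> absorbs A B) -> nbhs 0 A.

End Completion.

(* Main.v *)
Require Import Defs.
From HB Require Import structures.
From mathcomp Require Import all_boot all_order all_algebra.
From mathcomp Require Import complex.
From mathcomp Require Import all_classical all_reals ereal topology normedtype convex exp.
From mathcomp Require Import interval_inference ring lra.
Set Implicit Arguments.
Unset Strict Implicit.
Unset Printing Implicit Defensive.
Import Order.TTheory GRing.Theory Num.Theory.
Import numFieldNormedType.Exports.
Local Open Scope classical_set_scope.
Local Open Scope ring_scope.

(** Let a_N and b_n denote the weights on X1 and on X2, and let v_n = 1 / b_n.

    The completed tensor product is identified with a space W of functions on
    X1 * X2, in which one can work with truncations. A function w >= 0 on X2 is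
    subordinate to (v_n) if it is bounded by a multiple of every v_n; these
    functions form the maximal Nachbin family of (v_n). W consists of the
    continuous f such that a_N(x) w(y) |f(x, y)| vanishes at infinity for all N
    and all subordinate w; it is complete ([nachbin_complete]). A tensor is
    mapped to its values on pairs of evaluations. On tensors the injective
    topology is that of W: evaluations multiplied by weights are in polars, and
    conversely the inductive limit topology is given by the norms sup w |g|
    ([V0C_nbhs0]), so that functionals in polars are estimated in one variable
    after the other ([eps_norm_le]). Tensors are dense in W by means of a
    partition of unity ([tensor_embedding_dense]). As completions are unique
    ([completes_unique]), it remains to show that W is ultrabornological.

    Regular decrease ensures that for every N each f in W belongs to a step:
    for some m, a_N(x) v_m(y) |f(x, y)| vanishes at infinity ([product_step]).
    Condition Omega applied to evaluations and condition DN applied to bumps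
    become inequalities between weights; for a common exponent theta, their
    product is

      b_m / a_M <= C (b_k / a_K)^theta (b_n / a_N)^(1 - theta)
                <= e b_n / a_N + S b_k / a_K

    ([combined_condition]). Here n is fixed, M depends on N only, e > 0 is
    arbitrary, and k and S depend on K, m and e.

    Let A be an absolutely convex set absorbing the Banach discs of W. Any
    family of bounds |f| <= S_K b_(k_K) / a_K, one for every K, defines a Banach
    disc, because W is complete. By a diagonal argument, A contains a ball
    |f| <= d b_n / a_N for some N and d ([absorbing_small_ball]). For every m, a
    function with |f| <= b_m / a_M is truncated at the height (d / 2) b_n / a_N:
    the low part is in A / 2, and by the inequality above the high part is in
    one of the Banach discs. Hence A absorbs the unit ball of every step (M, m)
    ([absorbing_steps]). Finally, for a suitable subordinate w, a function with
    2 a_M w |f| <= 1 is a finite sum of slices lying in small multiples of these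
    balls ([slice_decomposition]), so that A is a neighbourhood of 0
    ([absorbing_nbhs]). *)

(** * Scalars *)

Section Scalars.
Context {R : realType} {c : scalar_kind}.
Local Notation K := (scalars R c).

Lemma real_scalar_gt0 (r : R) : 0 < r -> 0 < real_scalar r :> K.
Proof. by rewrite -(@real_scalar0 R c) Defs.ltr_real. Qed.

Lemma real_scalar_neq0 (r : R) : 0 < r -> real_scalar r != 0 :> K.
Proof. by move=> /real_scalar_gt0; rewrite lt0r => /andP[]. Qed.

Lemma real_scalarN (r : R) : real_scalar (- r) = - real_scalar r :> K.
Proof.
by apply/eqP; rewrite -addr_eq0 -real_scalarD addNr real_scalar0.
Qed.

Lemma modulusB_sym (x y : K) : modulus (x - y) = modulus (y - x).
Proof. by rewrite -modulusN opprB. Qed.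

Lemma modulusBD (x y z : K) : modulus (x - z) <= modulus (x - y) + modulus (y - z).
Proof. by rewrite (le_trans _ (modulusD _ _))// addrA subrK. Qed.

Lemma modulus_sum (I : Type) (s : seq I) (F : I -> K) :
  modulus (\sum_(i <- s) F i) <= \sum_(i <- s) modulus (F i).
Proof.
elim: s => [|i s IH]; first by rewrite !big_nil modulus0.
by rewrite !big_cons (le_trans (modulusD _ _))// lerD2l.
Qed.

Lemma real_scalar_sum (I : Type) (s : seq I) (F : I -> R) :
  real_scalar (\sum_(i <- s) F i) = \sum_(i <- s) real_scalar (F i) :> K.
Proof.
elim: s => [|i s IH]; first by rewrite !big_nil real_scalar0.
by rewrite !big_cons real_scalarD IH.
Qed.

Lemma modulus_eq0 (x : K) : modulus x <= 0 -> x = 0.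
Proof. by move=> x0; apply/eqP/negPn; rewrite -modulus_gt0 -leNgt. Qed.

Lemma modulus_cvgP (T : Type) (F : set_system T) (FF : Filter F) (f : T -> K^o)
    (l : K) :
  (f @ F --> (l : K^o)) <->
  forall e : R, 0 < e -> \forall t \near F, modulus (l - f t) < e.
Proof.
split=> [fl e e0|fl].
  move/cvgrPdist_lt : fl => /(_ _ (real_scalar_gt0 e0)).
  by apply: filterS => t; rewrite modulus_lt.
apply/cvgrPdist_lt => e e0.
have m0 : 0 < modulus e by rewrite modulus_gt0 gt_eqF.
have := fl _ m0; apply: filterS => t.
by rewrite -modulus_lt real_modulus (gtr0_norm e0).
Qed.

Lemma real_scalar_continuous : continuous (real_scalar : R -> K^o).
Proof.
move=> x; apply/modulus_cvgP => e e0.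
have /cvgrPdist_lt/(_ e e0) : y @[y --> (x : R)] --> (x : R) by exact: cvg_id.
apply: filterS => y; rewrite -real_scalarN -real_scalarD => xy.
suff -> : modulus (real_scalar (x - y) : K) = `|x - y| by [].
have [h|/ltW h] := leP 0 (x - y); first by rewrite modulus_real// ger0_norm.
by rewrite -modulusN -real_scalarN modulus_real ?oppr_ge0// ler0_norm.
Qed.

(** The complex case reduces to the completeness of the real line by taking
    real and imaginary parts. *)
Lemma scalars_complete (T : Type) (F : set_system T) (f : T -> K) :
  ProperFilter F ->
  (forall e : R, 0 < e -> exists2 A, F A &
     forall x y, A x -> A y -> modulus (f x - f y) < e) ->
  exists l : K, forall e : R, 0 < e -> \forall t \near F, modulus (l - f t) < e.
Proof.
have real_case (G : set_system T) (g : T -> R) : ProperFilter G ->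
    (forall e : R, 0 < e -> exists2 A, G A &
       forall x y, A x -> A y -> `|g x - g y| < e) ->
    exists l, forall e : R, 0 < e -> \forall t \near G, `|l - g t| < e.
  move=> PG gG; have : cauchy (g @ G).
    apply: cauchy_exP => e e0; have [A GA Ae] := gG _ e0.
    have [a Aa] := filter_ex GA.
    exists (g a); rewrite -ball_normE; rewrite /nbhs/=; apply: filterS GA => t At /=.
    exact: Ae.
  move=> /cauchy_cvg gl; exists (lim (g @ G)) => e e0.
  by move/cvgrPdist_lt : gl => /(_ _ e0).
move: f; rewrite /scalars/modulus; case: c => f PF fF; first exact: real_case.
have [] := real_case F (fun t => complex.Re (f t)) PF.
  move=> e /fF[A FA Ae]; exists A => // x y Ax Ay.
  rewrite (le_lt_trans _ (Ae _ _ Ax Ay))//=.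
  case: (f x) (f y) => [a b] [a' b'] /=.
  by rewrite -sqrtr_sqr ler_wsqrtr// lerDl sqr_ge0.
move=> a aF; have [] := real_case F (fun t => complex.Im (f t)) PF.
  move=> e /fF[A FA Ae]; exists A => // x y Ax Ay.
  rewrite (le_lt_trans _ (Ae _ _ Ax Ay))//=.
  case: (f x) (f y) => [p b] [p' b'] /=.
  by rewrite -sqrtr_sqr ler_wsqrtr// lerDr sqr_ge0.
move=> b bF; exists (a +i* b)%C => e e0.
have e2 : 0 < e / 2 by rewrite divr_gt0.
near=> t.
have h1 : `|a - complex.Re (f t)| < e / 2 by near: t; exact: aF.
have h2 : `|b - complex.Im (f t)| < e / 2 by near: t; exact: bF.
move: h1 h2; case: (f t) => p q /= h1 h2.
rewrite (@le_lt_trans _ _ (`|a - p| + `|b - q|))//; last first.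
  by rewrite (splitr e) ltrD.
rewrite -[leRHS]ger0_norm ?addr_ge0// -sqrtr_sqr ler_wsqrtr//.
rewrite -[(a - p) ^+ 2]real_normK ?num_real//.
rewrite -[(b - q) ^+ 2]real_normK ?num_real// sqrrD.
rewrite addrAC lerDl.
by rewrite mulrn_wge0// mulr_ge0.
Unshelve. all: by end_near. Qed.

End Scalars.

(** * Topological vector spaces, Banach discs and completions *)

Section Neighbourhoods.
Context {R : realType} {c : scalar_kind}.
Local Notation K := (scalars R c).
Context {E : tvsType K}.

Lemma nbhs_translate (x : E) (U : set E) :
  nbhs x U <-> nbhs 0 [set y | U (x + y)].
Proof.
split=> [xU|U0].
  have := nbhsB (- x) xU; rewrite addNr; apply: filterS => _ [z Uz <-] /=.
  by rewrite addNKr.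
by have := nbhsT x U0; apply: filterS => _ [y Uxy <-].
Qed.

Lemma nbhs0_scale (U : set E) (k : K) : k != 0 ->
  nbhs 0 U -> nbhs 0 [set y : E | U (k *: y)].
Proof.
move=> k0 U0; have k0' : k^-1 != 0 by rewrite invr_eq0.
have := nbhs0Z k0' U0; apply: filterS => _ [y Uy <-] /=.
by rewrite scalerA mulfV// scale1r.
Qed.

Lemma nbhs0_split (U : set E) : nbhs 0 U -> exists V,
  [/\ nbhs (0 : E) V, forall x, V x -> V (- x) &
      forall x y, V x -> V y -> U (x + y)].
Proof.
move=> U0; have /= := @add_continuous E (0, 0) U.
rewrite addr0 => /(_ U0)[[A B] [/= A0 B0] AB].
have AB0 : nbhs (0 : E) (A `&` B) by exact: filterI.
have N1 : (-1 : K) != 0 by rewrite oppr_eq0 oner_eq0.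
exists ((A `&` B) `&` [set x | (A `&` B) (-1 *: x)]); split.
- by apply: filterI => //; exact: nbhs0_scale.
- by move=> x [ABx /= ABNx]; rewrite scaleN1r in ABNx; split; rewrite //= scaleN1r opprK.
- by move=> x y [[Ax _] _] [[_ By] _]; exact: (AB (x, y)).
Qed.

Lemma nbhs0_split3 (U : set E) : nbhs 0 U -> exists V,
  [/\ nbhs (0 : E) V, forall x, V x -> V (- x) &
      forall x y z, V x -> V y -> V z -> U (x + y + z)].
Proof.
move=> /nbhs0_split[V [V0 VN VU]].
have [W [W0 WN WV]] := nbhs0_split V0.
exists W; split=> // x y z Wx Wy Wz; apply: VU; first exact: WV.
by rewrite -(addr0 z); apply: WV => //; exact: nbhs_singleton.
Qed.

End Neighbourhoods.

Section BanachDiscs.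
Context {R : realType} {c : scalar_kind}.
Local Notation K := (scalars R c).
Context {E : tvsType K} (B : set E).
Hypothesis Bc : absolutely_convex B.

Lemma absolutely_convex_scale (a : K) x : modulus a <= 1 -> B x -> B (a *: x).
Proof.
move=> a1 Bx; have := Bc.2 a 0 x 0; rewrite scaler0 addr0 modulus0 addr0.
by apply => //; exact: Bc.1.
Qed.

Lemma absolutely_convex_real (t : R) x : 0 <= t <= 1 -> B x ->
  B (real_scalar t *: x).
Proof.
by case/andP=> t0 t1; apply: absolutely_convex_scale; rewrite modulus_real.
Qed.

Lemma gauge_domain_lt x e : disc_span B x -> gauge B x < e ->
  exists2 y, B y & x = real_scalar e *: y.
Proof.
move=> Bx /(inf_lt Bx)[t [t0 [y By <-]] te].
have e0 : 0 < e by exact: lt_trans te.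
exists (real_scalar (t / e) *: y).
  apply: absolutely_convex_real By.
  by rewrite divr_ge0 ?(ltW t0) ?(ltW e0)//= ler_pdivrMr// mul1r ltW.
by rewrite scalerA -real_scalarM mulrCA mulfV ?gt_eqF// mulr1.
Qed.

Lemma gauge_le (e : R) y : 0 < e -> B y -> gauge B (real_scalar e *: y) <= e.
Proof.
move=> e0 By; apply: ge_inf; first by exists 0 => t [/ltW].
by split=> //; exists y.
Qed.

Lemma disc_spanB x y : disc_span B x -> disc_span B y -> disc_span B (x - y).
Proof.
move=> [s [s0 [x' Bx <-]]] [t [t0 [y' By <-]]].
have st0 : 0 < s + t by rewrite addr_gt0.
exists (s + t); split => //.
exists (real_scalar (s / (s + t)) *: x' + real_scalar (- (t / (s + t))) *: y').
  apply: Bc.2 => //; rewrite real_scalarN modulusN !modulus_real; last 2 first.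
  - by rewrite divr_ge0// ltW.
  - by rewrite divr_ge0// ltW.
  by rewrite -mulrDl mulfV ?gt_eqF.
rewrite scalerDr !scalerA -!real_scalarM mulrN !(mulrCA (s + t)).
by rewrite mulfV ?gt_eqF// !mulr1 real_scalarN scaleNr.
Qed.

(** In a complete space, the gauge topology of a bounded disc is finer than
    the ambient one, so that gauge-Cauchy sequences converge, and closedness
    turns the ambient limit into a gauge limit. *)
Lemma banach_disc_complete : tvs_complete E -> tvs_bounded B ->
  (forall x, (forall U, nbhs (0 : E) U -> exists2 y, B y & U (x - y)) -> B x) ->
  banach_disc B.
Proof.
move=> Ecomplete Bbounded Bclosed; split=> // u uB ucauchy.
have diff (e : R) : 0 < e -> exists N, forall m n, (N <= m)%N -> (N <= n)%N ->
    exists2 y, B y & u m - u n = real_scalar e *: y.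
  move=> /ucauchy[N uN]; exists N => m n Nm Nn.
  by apply: gauge_domain_lt; [exact: disc_spanB|exact: uN].
have [|x ux] := Ecomplete (u @ \oo) _.
  move=> U /Bbounded[r r0 BU].
  have rV : 0 < r^-1 by rewrite invr_gt0.
  have [N uN] := diff _ rV.
  exists [set u n | n in [set n | (N <= n)%N]].
    by exists N => // n Nn; exists n.
  move=> _ _ [m Nm <-] [n Nn <-]; have [y By ->] := uN _ _ Nm Nn.
  have /(_ (real_scalar r)) := BU; rewrite modulus_real ?(ltW r0)// lexx.
  move=> /(_ isT _ By)[z Uz <-].
  by rewrite scalerA -real_scalarM mulVf ?gt_eqF// real_scalar1 scale1r.
have ux0 V : nbhs (0 : E) V -> exists M, forall m, (M <= m)%N -> V (u m - x).
  move=> V0; have : nbhs x [set y | V (y - x)].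
    apply/nbhs_translate; apply: filterS V0 => y Vy /=.
    by rewrite addrC addKr.
  by move=> /ux[M _ uM]; exists M => m /uM.
have lim (e : R) : 0 < e -> exists N, forall n, (N <= n)%N ->
    exists2 y, B y & u n - x = real_scalar e *: y.
  move=> e0; have [N uN] := diff _ e0; exists N => n Nn.
  have e1 := @real_scalar_neq0 _ c _ e0.
  have eV : real_scalar e^-1 * real_scalar e = 1 :> K.
    by rewrite -real_scalarM mulVf ?gt_eqF// real_scalar1.
  exists (real_scalar e^-1 *: (u n - x)); last first.
    by rewrite scalerA mulrC eV scale1r.
  apply: Bclosed => U U0.
  have [M uM] : exists M, forall m, (M <= m)%N ->
      U (real_scalar e^-1 *: (u m - x)).
    apply: (ux0 [set z | U (real_scalar e^-1 *: z)]); apply: nbhs0_scale => //.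
    by apply: real_scalar_neq0; rewrite invr_gt0.
  have [y By uy] := uN n (maxn M N) Nn (leq_maxr _ _).
  exists y => //; rewrite -[y]scale1r -eV -scalerA -uy -scalerBr.
  rewrite opprB addrC addrA subrK.
  exact/uM/leq_maxl.
have [N uN] := lim _ ltr01; have [y By uNx] := uN _ (leqnn N).
exists x.
  rewrite -(subKr (u N) x); apply: disc_spanB => //.
  by exists 1; split => //; exists y.
move=> e e0; have e2 : 0 < e / 2 by rewrite divr_gt0.
have [M uM] := lim _ e2; exists M => n /uM[z Bz ->].
by rewrite (le_lt_trans (gauge_le e2 Bz))// ltr_pdivrMr// ltr_pMr// ltr1n.
Qed.

End BanachDiscs.

Section Isomorphism.
Context {R : realType} {c : scalar_kind}.
Local Notation K := (scalars R c).

(** Topological isomorphisms, with the inverse as part of the data. *)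
Record tvs_iso (E G : tvsType K) (f : E -> G) (g : G -> E) : Prop := TvsIso {
  iso_linear : linear f ;
  iso_inv_linear : linear g ;
  isoK : cancel f g ;
  iso_invK : cancel g f ;
  iso_nbhs0 : forall U, nbhs (0 : G) U -> nbhs 0 (f @^-1` U) ;
  iso_inv_nbhs0 : forall U, nbhs (0 : E) U -> nbhs 0 (g @^-1` U)
}.

Section Transfer.
Context (E G : tvsType K) (f : E -> G) (g : G -> E).
Hypothesis fg : tvs_iso f g.
Let f_linear := iso_linear fg.
Let fK := isoK fg.
Let gK := iso_invK fg.

Let fD x y : f (x + y) = f x + f y.
Proof. by rewrite -[x]scale1r f_linear !scale1r. Qed.

Let f0 : f 0 = 0.
Proof. by apply: (addrI (f 0)); rewrite -fD !addr0. Qed.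

Let fZ a x : f (a *: x) = a *: f x.
Proof. by rewrite -[a *: x]addr0 f_linear f0 addr0. Qed.

Lemma iso_absolutely_convex (B : set G) :
  absolutely_convex B -> absolutely_convex (f @^-1` B).
Proof.
move=> [B0 Bc]; split=> [|a b x y ab Bx By]; first by rewrite /= f0.
by rewrite /= fD !fZ; exact: Bc.
Qed.

Lemma iso_gauge_domain (B : set E) x :
  gauge_domain (g @^-1` B) (f x) = gauge_domain B x.
Proof.
apply/seteqP; split=> t [t0 [y By yx]]; split => //.
  by exists (g y) => //; apply: (can_inj fK); rewrite fZ gK.
by exists (f y); rewrite /= ?fK// -yx fZ.
Qed.

Lemma iso_absorbs (A : set G) (B : set E) :
  absorbs A (g @^-1` B) -> absorbs (f @^-1` A) B.
Proof.
move=> [r r0 BA]; exists r => // a ra x Bx.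
have [|y Ay yx] := BA a ra (f x); first by rewrite /= fK.
exists (g y); first by rewrite /= gK.
by apply: (can_inj fK); rewrite fZ gK.
Qed.

End Transfer.

Lemma tvs_iso_sym (E G : tvsType K) (f : E -> G) (g : G -> E) :
  tvs_iso f g -> tvs_iso g f.
Proof. by case. Qed.

Lemma iso_banach_disc (E G : tvsType K) (f : E -> G) (g : G -> E) B :
  tvs_iso f g -> banach_disc B -> banach_disc (g @^-1` B).
Proof.
move=> fg [Bc Bb Bcomplete].
have gf := tvs_iso_sym fg.
have gE x y : g (x - y) = g x - g y.
  rewrite -[x - y]addrC -scaleN1r (iso_linear gf) scaleN1r addrC.
  by [].
have gaugeE x : gauge (g @^-1` B) x = gauge B (g x).
  by rewrite /gauge -{1}(iso_invK fg x) (iso_gauge_domain fg).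
have spanE x : disc_span (g @^-1` B) x = disc_span B (g x).
  by rewrite /disc_span/= -{1}(iso_invK fg x) (iso_gauge_domain fg).
split; first exact: (iso_absolutely_convex gf).
  move=> U U0.
  have := Bb _ (iso_nbhs0 fg U0).
  have {1}-> : B = f @^-1` (g @^-1` B).
    by apply/funext => x; rewrite /preimage/= (isoK fg).
  move=> /(iso_absorbs gf); congr (absorbs _ _).
  by apply/funext => x; rewrite /preimage/= (iso_invK fg).
move=> u uB ucauchy; have [|e e0|x Bx ux] := Bcomplete (g \o u).
- by move=> n; rewrite /= -spanE.
- have [N uN] := ucauchy e e0; exists N => m n Nm Nn.
  by rewrite /= -gE -gaugeE; exact: uN.
exists (f x); first by rewrite spanE (isoK fg).
move=> e e0; have [N uN] := ux e e0; exists N => n Nn.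
by rewrite gaugeE gE (isoK fg); exact: uN.
Qed.

Lemma iso_ultrabornological (E G : tvsType K) (f : E -> G) (g : G -> E) :
  tvs_iso f g -> ultrabornological E -> ultrabornological G.
Proof.
move=> fg ubE A Ac AB; have A0 : nbhs 0 (f @^-1` A).
  apply: ubE; first exact: iso_absolutely_convex fg _ Ac.
  by move=> B Bd; apply: (iso_absorbs fg); apply: AB; exact: (iso_banach_disc fg Bd).
have := iso_inv_nbhs0 fg A0; apply: filterS => x /=.
by rewrite (iso_invK fg).
Qed.

End Isomorphism.

Section UniqueCompletion.
Context {R : realType} {c : scalar_kind}.
Local Notation K := (scalars R c).
Context {H : tvsType K}.

(** The part of the notion of completion that determines it, with density and
    separation expressed by neighbourhoods of 0. *)
Record completes (E : tvsType K) (i : {linear H -> E}) : Prop := Completes {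
  completes_separated : forall x, (forall U, nbhs (0 : E) U -> U x) -> x = 0 ;
  completes_complete : tvs_complete E ;
  completes_nbhs : forall W : set H,
    nbhs 0 W <-> exists2 U, nbhs (0 : E) U & i @^-1` U `<=` W ;
  completes_dense : forall x U, nbhs (0 : E) U -> exists h, U (i h - x)
}.

Lemma completion_completes (G : tvsType K) (j : {linear H -> G}) :
  is_completion j -> completes j.
Proof.
case=> Gh Gc _ Gn Gd; split => //.
  move=> x Ux; apply/esym/Gh => A B A0 Bx.
  by exists x; split; [exact: Ux|exact: nbhs_singleton].
move=> x U U0; have : nbhs x [set y | U (y - x)].
  apply/nbhs_translate; apply: filterS U0 => y Uy /=.
  by rewrite addrC addKr.
rewrite nbhsE => -[V [Vo Vx] VU].
have [|y [/VU Uy [h _ hy]]] := Gd V _ Vo; first by exists x.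
by exists h; rewrite hy.
Qed.

(** The isomorphism between two completions is the closure, in the product,
    of the set of pairs of images of the points of H. *)
Definition limit_pair (E G : tvsType K) (i : H -> E) (j : H -> G) (x : E)
    (y : G) :=
  forall U V, nbhs (0 : E) U -> nbhs (0 : G) V ->
    exists2 h, U (i h - x) & V (j h - y).

Lemma limit_pair_sym (E G : tvsType K) (i : H -> E) (j : H -> G) x y :
  limit_pair i j x y -> limit_pair j i y x.
Proof. by move=> xy U V U0 V0; have [h] := xy V U V0 U0; exists h. Qed.

Section LimitPair.
Context (E G : tvsType K) (i : {linear H -> E}) (j : {linear H -> G}).
Hypotheses (iE : completes i) (jG : completes j).

Let transfer_nbhs (V : set G) : nbhs 0 V ->
  exists2 U, nbhs (0 : E) U & forall h, U (i h) -> V (j h).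
Proof.
move=> V0; have /(completes_nbhs iE)[U U0 UV] : nbhs 0 (j @^-1` V).
  by apply/(completes_nbhs jG); exists V.
by exists U.
Qed.

Lemma limit_pair_total x : exists y, limit_pair i j x y.
Proof.
pose near_x (U : set E) := [set h | U (i h - x)].
pose F := filter_from (nbhs (0 : E)) near_x.
have FF : ProperFilter F.
  apply: filter_from_proper; last first.
    by move=> U U0; have [h Uh] := completes_dense iE x U0; exists h.
  apply: filter_from_filter; first by exists setT; exact: filterT.
  move=> U U' U0 U'0; exists (U `&` U') => //; exact: filterI.
have [|y Fy] := completes_complete jG (fmap_proper_filter j FF).
  move=> V /transfer_nbhs[U U0 UV].
  have [U' [U'0 U'N U'U]] := nbhs0_split U0.
  exists (j @` near_x U').
    by exists U' => // h Uh; exists h.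
  move=> _ _ [h Uh <-] [h' Uh' <-]; rewrite -linearB; apply: UV.
  have -> : i (h - h') = (i h - x) + - (i h' - x).
    by rewrite linearB opprB addrA subrK.
  by apply: U'U => //; exact: U'N.
exists y => U V U0 V0.
have /Fy[U' U'0 U'V] : nbhs y [set z | V (z - y)].
  apply/nbhs_translate; apply: filterS V0 => z Vz /=.
  by rewrite addrC addKr.
have [h [Uh U'h]] := completes_dense iE x (filterI U0 U'0).
by exists h => //; exact: U'V.
Qed.

Lemma limit_pair_fun x y y' :
  limit_pair i j x y -> limit_pair i j x y' -> y = y'.
Proof.
move=> xy xy'; apply/eqP; rewrite -subr_eq0; apply/eqP.
apply: (completes_separated jG) => V V0.
have [V' [V'0 V'N V'V]] := nbhs0_split3 V0.
have [U U0 UV] := transfer_nbhs V'0.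
have [U' [U'0 U'N U'U]] := nbhs0_split U0.
have [h Uh Vh] := xy U' V' U'0 V'0.
have [h' Uh' Vh'] := xy' U' V' U'0 V'0.
have -> : y - y' = - (j h - y) + j (h - h') + (j h' - y').
  by rewrite (linearB j) opprB !addrA !subrK.
apply: V'V => //; first exact: V'N.
apply: UV; have -> : i (h - h') = (i h - x) + - (i h' - x).
  by rewrite linearB opprB addrA subrK.
by apply: U'U => //; exact: U'N.
Qed.

Lemma limit_pair_linear a x y x' y' : limit_pair i j x y ->
  limit_pair i j x' y' -> limit_pair i j (a *: x + x') (a *: y + y').
Proof.
move=> xy xy' U V U0 V0.
have [U' [U'0 _ U'U]] := nbhs0_split U0.
have [V' [V'0 _ V'V]] := nbhs0_split V0.
have scaled (L : tvsType K) (W : set L) : nbhs (0 : L) W ->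
    nbhs 0 [set z : L | W (a *: z)].
  move=> W0; have [->|a0] := eqVneq a 0; last exact: nbhs0_scale.
  apply: filterS filterT => z _ /=; rewrite scale0r; exact: nbhs_singleton.
have [h Uh Vh] := xy _ _ (scaled _ _ U'0) (scaled _ _ V'0).
have [h' Uh' Vh'] := xy' U' V' U'0 V'0.
exists (a *: h + h').
  by rewrite linearP opprD addrACA -scalerBr; exact: U'U.
by rewrite linearP opprD addrACA -scalerBr; exact: V'V.
Qed.

Lemma limit_pair_continuous (V : set G) : nbhs 0 V ->
  nbhs 0 [set x | forall y, limit_pair i j x y -> V y].
Proof.
move=> V0; have [V' [V'0 V'N V'V]] := nbhs0_split V0.
have [U U0 UV] := transfer_nbhs V'0.
have [U' [U'0 U'N U'U]] := nbhs0_split U0.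
apply: (filterS _ (U'0)) => x U'x y xy; have [h Uh Vh] := xy U' V' U'0 V'0.
rewrite -(subKr (j h) y) -[j h - _]/(j h + - (j h - y)).
apply: V'V; last exact: V'N.
by apply: UV; rewrite -(subrK x (i h)); exact: U'U.
Qed.

End LimitPair.

Theorem completes_unique (E G : tvsType K) (i : {linear H -> E})
    (j : {linear H -> G}) :
  completes i -> completes j -> exists f g, @tvs_iso R c E G f g.
Proof.
move=> iE jG.
have [f fP] := choice (limit_pair_total iE jG).
have [g gP] := choice (limit_pair_total jG iE).
exists f, g; split.
- move=> a x y; apply: (limit_pair_fun iE jG) (fP _) _.
  exact: limit_pair_linear.
- move=> a x y; apply: (limit_pair_fun jG iE) (gP _) _.
  exact: limit_pair_linear.
- by move=> x; apply: (limit_pair_fun jG iE) (gP _) _; exact: limit_pair_sym.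
- by move=> x; apply: (limit_pair_fun iE jG) (fP _) _; exact: limit_pair_sym.
- move=> U /(limit_pair_continuous iE jG); apply: filterS => x; exact.
- move=> U /(limit_pair_continuous jG iE); apply: filterS => x; exact.
Qed.

End UniqueCompletion.

(** * Bumps and partitions of unity *)

Section CompactSets.
Context {R : realType} {Y : topologicalType}.

(** Finite sets of centres, ordered by inclusion, form a filter, along which
    every point of L is eventually covered near itself. *)
Lemma compact_finite_cover (L : set Y) (O : Y -> set Y) : compact L ->
  (forall x, L x -> nbhs x (O x)) ->
  exists s : seq Y, forall x, L x -> exists2 z, z \in s & O z x.
Proof.
move=> /compact_near_coveringP Lc LO.
pose F : set_system (seq Y) :=
  filter_from setT (fun s : seq Y => [set t : seq Y | {subset s <= t}]).
have FF : Filter F.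
  apply: filter_from_filter; first by exists [::].
  move=> s t _ _; exists (s ++ t) => // u stu.
  by split=> x xs; apply: stu; rewrite mem_cat xs ?orbT.
have [|s _ sL] := Lc _ F (fun s x => exists2 z, z \in s & O z x) FF.
  move=> x Lx; exists (O x, [set t : seq Y | {subset [:: x] <= t}]).
    by split; [exact: LO|exists [:: x]].
  move=> [y t] [/= Oxy xt]; exists x => //.
  by apply: xt; rewrite inE.
by exists s; apply: sL.
Qed.

Hypotheses (Yh : hausdorff_space Y) (Yl : locally_compact [set: Y]).

Lemma bump (x : Y) (U : set Y) : nbhs x U -> exists u : Y -> R,
  [/\ continuous u, forall y, 0 <= u y <= 1, u x = 1,
      forall y, ~ U y -> u y = 0 &
      exists2 L, compact L & forall y, ~ L y -> u y = 0].
Proof.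
move=> xU; have [L xL [Lc _]] := Yl (I : [set: Y] x).
have {}xL : nbhs x L by move: xL; rewrite /within/=; apply: filterS => y; exact.
have /(@locally_compact_completely_regular _ R Yl Yh x) : closed (~` (U `&` L)^°).
  exact/open_closedC/open_interior.
have xUL : (U `&` L)^° x by apply: filterI.
move=> /(_ (fun h => h xUL))/uniform_separatorP => /(_ R).
case=> u [uc u01 ux uU].
have u01' y : 0 <= u y <= 1.
  by have /u01 : range u (u y) by exists y; rewrite //= in_itv.
have uUL y : ~ (U `&` L) y -> u y = 1.
  by move=> ULy; apply: uU; exists y => // /interior_subset.
exists (fun y => 1 - u y); split.
- by move=> y; apply: cvgB; [exact: cvg_cst|exact: uc].
- by move=> y; move: (u01' y); lra.
- by have -> : u x = 0; [apply: ux; exists x|rewrite subr0].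
- by move=> y Uy; rewrite uUL ?subrr// => -[].
- by exists L => // y Ly; rewrite uUL ?subrr// => -[].
Qed.

Lemma continuous_seq_sum (I : Type) (s : seq I) (u : I -> Y -> R) :
  (forall i, continuous (u i)) -> continuous (fun y => \sum_(i <- s) u i y).
Proof.
move=> uc; elim: s => [|i s IH] y.
  by under eq_fun do rewrite big_nil; exact: cvg_cst.
by under eq_fun do rewrite big_cons; apply: cvgD; [exact: uc|exact: IH].
Qed.

Lemma continuous_div (u v : Y -> R) : continuous u -> continuous v ->
  (forall y, 0 < v y) -> continuous (fun y => u y / v y).
Proof.
move=> uc vc v0 y; apply: cvgM; first exact: uc.
by apply: cvgV; [rewrite gt_eqF|exact: vc].
Qed.

Lemma continuous_maxr (u v : Y -> R) : continuous u -> continuous v ->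
  continuous (fun y => Num.max (u y) (v y)).
Proof. by move=> uc vc y; apply: continuous_max; [exact: uc|exact: vc]. Qed.

(** The bumps of a finite cover are divided by the maximum of 1/2 and of their
    sum, which is their sum on L. *)
Lemma partition_of_unity (L : set Y) (O : Y -> set Y) : compact L ->
  (forall x, nbhs x (O x)) ->
  exists (s : seq Y) (u : Y -> Y -> R), [/\ forall z, continuous (u z),
    forall z y, 0 <= u z y,
    forall z, (forall y, ~ O z y -> u z y = 0) /\
      exists2 M, compact M & forall y, ~ M y -> u z y = 0,
    forall y, \sum_(z <- s) u z y <= 1 &
    forall y, L y -> \sum_(z <- s) u z y = 1].
Proof.
move=> Lc xO.
have [u uP] := choice (fun z => bump (xO z)).
have u0 z y : 0 <= u z y by have [_ /(_ y)/andP[]] := uP z.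
have uc z : continuous (u z) by have [] := uP z.
have [|s sL] := @compact_finite_cover L (fun z => [set y | 2^-1 < u z y]) Lc.
  move=> x _; have [_ _ ux _ _] := uP x.
  have h0 : 0 < 2^-1 :> R by rewrite invr_gt0.
  move/cvgrPdist_lt : (uc x x) => /(_ _ h0); apply: filterS => y /=.
  by rewrite ux ltr_norml => /andP[_]; lra.
pose S y := \sum_(z <- s) u z y.
pose m y := Num.max (S y) 2^-1.
have m0 y : 0 < m y by rewrite lt_max invr_gt0 ltr0n orbT.
have SE y : \sum_(z <- s) u z y / m y = S y / m y by rewrite -mulr_suml.
exists s, (fun z y => u z y / m y); split.
- move=> z; apply: continuous_div => //; apply: continuous_maxr.
    exact: continuous_seq_sum.
  by move=> y; exact: cvg_cst.
- by move=> z y; rewrite divr_ge0// ltW.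
- move=> z; have [_ _ _ uO [M Mc uM]] := uP z.
  split=> [y /uO ->|]; first by rewrite mul0r.
  by exists M => // y /uM ->; rewrite mul0r.
- by move=> y; rewrite SE ler_pdivrMr// mul1r le_max lexx.
- move=> y /sL[z zs /= uzy]; rewrite SE.
  have Sy : 2^-1 < S y.
    by rewrite (lt_le_trans uzy)// /S (big_rem z)//= lerDl sumr_ge0.
  by rewrite /m max_l ?(ltW Sy)// mulfV// gt_eqF// (lt_trans _ Sy)// invr_gt0.
Qed.

Lemma plateau (L : set Y) : compact L -> exists u : Y -> R,
  [/\ continuous u, forall y, 0 <= u y <= 1, forall y, L y -> u y = 1 &
      exists2 M, compact M & forall y, ~ M y -> u y = 0].
Proof.
move=> Lc; have [s [u [uc u0 uP u1 uL]]] :=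
  partition_of_unity Lc (fun x => @filterT _ (nbhs x) _).
exists (fun y => \sum_(z <- s) u z y); split => //.
- exact: continuous_seq_sum.
- by move=> y; rewrite u1 sumr_ge0.
have /choice[M MP] : forall z, exists M, compact M /\ forall y, ~ M y -> u z y = 0.
  by move=> z; have [_ [M Mc uM]] := uP z; exists M.
exists (\big[setU/set0]_(z <- s) M z).
  by apply: bigsetU_compact => z _; have [] := MP z.
elim: s {u1 uL} => [|z s IH] y; first by rewrite !big_nil.
rewrite !big_cons => /not_orP[Mz Ms]; rewrite IH// addr0.
by have [_ ->] := MP z.
Qed.

End CompactSets.

(** * Function spaces defined by Nachbin families *)

(** A directed set of weights, bounded on compact sets and locally bounded
    away from 0; its members need not be continuous, as for the maximal
    Nachbin family associated with a decreasing sequence of weights. *)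
Record nachbin_family (R : realType) (Y : topologicalType) := NachbinFamily {
  nachbin_index : Type ;
  nachbin_weight :> nachbin_index -> Y -> R ;
  nachbin_point : nachbin_index ;
  nachbin_ge0 : forall j y, 0 <= nachbin_weight j y ;
  nachbin_bounded : forall j L, compact L ->
    exists M, forall y, L y -> nachbin_weight j y <= M ;
  nachbin_directed : forall i j (M : R), exists k, forall y,
    M * nachbin_weight i y <= nachbin_weight k y /\
    nachbin_weight j y <= nachbin_weight k y ;
  nachbin_locally_positive : forall y : Y, exists j, exists2 d, 0 < d &
    \forall z \near y, d <= nachbin_weight j z
}.

Section Vanishing.
Context {R : realType} {c : scalar_kind} {Y : topologicalType}.
Local Notation K := (scalars R c).
Implicit Types (w : Y -> R) (f g : Y -> K^o).

Definition vanishing w f := forall e : R, 0 < e ->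
  exists2 L : set Y, compact L & forall y, ~ L y -> w y * modulus (f y) < e.

Lemma vanishing_le w w' (M : R) f : (forall y, 0 <= w y) ->
  (forall y, w' y <= M * w y) -> vanishing w f -> vanishing w' f.
Proof.
move=> w0 ww' fw e e0; have M0 : 0 < `|M| + 1 by rewrite ltr_wpDl.
have [|L Lc Lf] := fw (e / (`|M| + 1)); first by rewrite divr_gt0.
exists L => // y /Lf; rewrite ltr_pdivlMr//; apply: le_lt_trans.
rewrite mulrAC ler_wpM2r ?modulus_ge0// (le_trans (ww' y))// mulrC ler_wpM2l//.
by rewrite (le_trans (ler_norm _))// lerDl.
Qed.

Lemma compact_modulus_bounded f (L : set Y) : continuous f -> compact L ->
  exists M : R, forall y, L y -> modulus (f y) <= M.
Proof.
move=> fc Lc; pose g y := modulus (f y).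
have gc : continuous g.
  by move=> y; apply: continuous_comp; [exact: fc|exact: modulus_continuous].
have : compact (g @` L).
  by apply: continuous_compact => //; exact: continuous_subspaceT.
move=> /compact_bounded[M [Mr /(_ (`|M| + 1))]].
rewrite ltr_pwDr// ?ler_norm// => /(_ isT) ML.
exists (`|M| + 1) => y Ly; apply: (le_trans (ler_norm _)).
by apply: ML; exists y.
Qed.

Lemma vanishing_bounded w f : (forall y, 0 <= w y) ->
  (forall L, compact L -> exists M, forall y, L y -> w y <= M) ->
  continuous f -> vanishing w f ->
  has_ubound [set w y * modulus (f y) | y in [set: Y]].
Proof.
move=> w0 wb fc /(_ _ ltr01)[L Lc Lf].
have [M wM] := wb L Lc; have [N fN] := compact_modulus_bounded fc Lc.
exists (Num.max 1 (M * N)) => _ [y _ <-].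
have [Ly|/Lf/ltW fy] := pselect (L y); last by rewrite le_max fy.
by rewrite le_max ler_pM ?modulus_ge0 ?wM ?fN ?orbT.
Qed.

Lemma vanishing0 w : vanishing w 0.
Proof.
by move=> e e0; exists set0; [exact: compact0|move=> y _; rewrite modulus0 mulr0].
Qed.

Lemma vanishingD w f g : (forall y, 0 <= w y) -> vanishing w f ->
  vanishing w g -> vanishing w (f + g).
Proof.
move=> w0 fw gw e e0; have e2 : 0 < e / 2 by rewrite divr_gt0.
have [L Lc Lf] := fw _ e2; have [M Mc Mg] := gw _ e2.
exists (L `|` M); first exact: compactU.
move=> y /not_orP[/Lf fy /Mg gy]; rewrite (splitr e).
apply: le_lt_trans (ltrD fy gy).
by rewrite -mulrDr ler_wpM2l// modulusD.
Qed.

Lemma vanishingZ w (a : K) f : (forall y, 0 <= w y) -> vanishing w f ->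
  vanishing w (a *: f).
Proof.
move=> w0 fw e e0; have a1 : 0 < modulus a + 1 by rewrite ltr_wpDl// modulus_ge0.
have [|L Lc Lf] := fw (e / (modulus a + 1)); first by rewrite divr_gt0.
exists L => // y /Lf; rewrite ltr_pdivlMr//; apply: le_lt_trans.
rewrite [modulus _](modulusM a (f y)) mulrCA mulrC ler_wpM2l ?mulr_ge0 ?modulus_ge0//.
by rewrite lerDl.
Qed.

Lemma continuous_linear_combination (a : K) f g : continuous f ->
  continuous g -> continuous (a *: f + g).
Proof.
move=> fc gc y; apply: (@cvgD K K^o _ (nbhs y)); last exact: gc.
by apply: (@cvgZl_tmp _ K^o); exact: fc.
Qed.

Definition rescale (u : Y -> R) f : Y -> K^o := fun y => real_scalar (u y) * f y.

Lemma modulus_rescale u f y : 0 <= u y ->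
  modulus (rescale u f y) = u y * modulus (f y).
Proof. by move=> u0; rewrite modulusM modulus_real. Qed.

Lemma rescale_continuous u f : continuous u -> continuous f ->
  continuous (rescale u f).
Proof.
move=> uc fc y; apply: (@cvgM K Y (nbhs y)); last exact: fc.
by apply: continuous_comp; [exact: uc|exact: real_scalar_continuous].
Qed.

Lemma vanishing_rescale w u f : (forall y, 0 <= w y) ->
  (forall y, 0 <= u y <= 1) -> vanishing w f -> vanishing w (rescale u f).
Proof.
move=> w0 u01 fw e /fw[L Lc Lf]; exists L => // y /Lf; apply: le_lt_trans.
have /andP[u0 u1] := u01 y.
rewrite modulus_rescale// mulrCA -[leRHS]mul1r ler_wpM2r//.
by rewrite mulr_ge0 ?modulus_ge0.
Qed.

End Vanishing.

(** The carrier of the ambient module is a function type only up to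
    conversion, so that the coercion to it does not allow application. *)
Definition linsub_fun (K : numFieldType) (Y : Type) (S : linsub (Y -> K^o))
  (f : linsub_type S) : Y -> K^o := linsub_val f.
Coercion linsub_fun : linsub_type >-> Funclass.

Lemma linsub_funD (K : numFieldType) (Y : Type) (S : linsub (Y -> K^o))
  (f g : linsub_type S) : (f + g : linsub_type S) = (f : Y -> K^o) + g :> (Y -> K^o).
Proof. by []. Qed.

Lemma linsub_funZ (K : numFieldType) (Y : Type) (S : linsub (Y -> K^o)) (a : K)
  (f : linsub_type S) : (a *: f : linsub_type S) = a *: (f : Y -> K^o) :> (Y -> K^o).
Proof. by []. Qed.

Lemma modulus_linsub_funZ (R : realType) (c : scalar_kind) (Y : Type)
    (S : linsub (Y -> (scalars R c)^o)) (k : scalars R c) (f : linsub_type S) y :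
  modulus ((k *: f : linsub_type S) y) = modulus k * modulus (f y).
Proof. by rewrite -modulusM. Qed.

Section NachbinSpace.
Context (R : realType) (c : scalar_kind) (Y : topologicalType).
Local Notation K := (scalars R c).
Context (V : nachbin_family R Y).

Let V0 j y : 0 <= V j y. Proof. exact: nachbin_ge0. Qed.

Definition nachbin_set : set (Y -> K^o) :=
  [set f | continuous f /\ forall j, vanishing (V j) f].

Lemma nachbin_set0 : nachbin_set 0.
Proof.
by split=> [y|j]; [exact: cvg_cst|exact: vanishing0].
Qed.

Lemma nachbin_set_closed a (f g : Y -> K^o) :
  nachbin_set f -> nachbin_set g -> nachbin_set (a *: f + g).
Proof.
move=> [fc fV] [gc gV]; split; first exact: continuous_linear_combination.
by move=> j; apply: vanishingD => //; exact: vanishingZ.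
Qed.

Definition nachbin_linsub := Linsub nachbin_set0 nachbin_set_closed.

Local Notation ns := (linsub_type nachbin_linsub).

Let bounded j (f : Y -> K^o) : nachbin_set f ->
  has_ubound [set V j y * modulus (f y) | y in [set: Y]].
Proof.
move=> [fc fV]; apply: vanishing_bounded => //; exact: nachbin_bounded.
Qed.

Definition nachbin_norm j (f : Y -> K^o) : R := weighted_sup [set: Y] (V j) f.

Let normD j (f g : ns) :
  nachbin_norm j (val (f + g)) <= nachbin_norm j (val f) + nachbin_norm j (val g).
Proof.
exact: (weighted_supD (V0 j) (bounded j (linsub_in f)) (bounded j (linsub_in g))).
Qed.

Let normZ j a (f : ns) :
  nachbin_norm j (val (a *: f)) = modulus a * nachbin_norm j (val f).
Proof. exact: (weighted_supZ (V0 j) a (bounded j (linsub_in f))). Qed.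

Definition nachbin_seminorm j : seminorm (linsub_type nachbin_linsub) :=
  @Seminorm R c (linsub_type nachbin_linsub) (fun f => nachbin_norm j (val f))
    (normD j) (normZ j).

Definition nachbin_space : tvsType K := seminormed nachbin_seminorm.

Lemma nachbin_norm_ub j (f : ns) y :
  V j y * modulus (f y) <= nachbin_seminorm j f.
Proof.
exact: (weighted_sup_ub (bounded j (linsub_in f)) (I : [set: Y] y)).
Qed.

Lemma nachbin_norm_le j (f : ns) (M : R) : 0 <= M ->
  (forall y, V j y * modulus (f y) <= M) -> nachbin_seminorm j f <= M.
Proof. by move=> M0 fM; apply: weighted_sup_le => // y _; exact: fM. Qed.

Lemma nachbin_upper_bound (s : seq (nachbin_index V)) (e : R) : 0 < e ->
  exists j, forall f : ns,
    (forall y, V j y * modulus (f y) <= 1) ->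
    seminorm_sum nachbin_seminorm s f < e.
Proof.
elim: s e => [|i s IH] e e0.
  by exists (nachbin_point V) => f _; rewrite /seminorm_sum big_nil.
have e2 : 0 < e / 2 by rewrite divr_gt0.
have [j jP] := IH _ e2; have [k kP] := nachbin_directed i j (e / 2)^-1.
exists k => f fk; rewrite /seminorm_sum big_cons (splitr e).
apply: ler_ltD; last first.
  apply: jP => y; apply: le_trans (fk y); rewrite ler_wpM2r ?modulus_ge0//.
  by have [] := kP y.
apply: nachbin_norm_le => [|y]; first exact: ltW.
rewrite -[leRHS]mulr1 -ler_pdivrMl// mulrA (le_trans _ (fk y))//.
by rewrite ler_wpM2r ?modulus_ge0//; have [] := kP y.
Qed.

(** Directedness gathers finitely many weights and their scalar factors into
    a single weight. *)
Lemma nachbin_nbhs0P (U : set (linsub_type nachbin_linsub)) :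
  nbhs (0 : nachbin_space) U <->
  exists j, forall f : ns,
    (forall y, V j y * modulus (f y) <= 1) -> U f.
Proof.
split=> [[s [e e0 sU]]|[j jU]].
  have [j jP] := nachbin_upper_bound s e0; exists j => f /jP fe.
  by apply: sU; rewrite /seminormed_ball/= subr0.
exists [:: j], 1 => // f; rewrite /seminormed_ball/= subr0.
rewrite /seminorm_sum big_seq1 => f1; apply: jU => y.
exact: le_trans (nachbin_norm_ub j f y) (ltW f1).
Qed.

Lemma nachbin_separated (f : nachbin_space) :
  (forall U, nbhs (0 : nachbin_space) U -> U f) -> f = 0.
Proof.
move=> fU; apply: val_inj; apply/funext => y.
have [j [d d0 jd]] := nachbin_locally_positive V y.
apply: modulus_eq0; apply/ler_addgt0Pr => e e0; rewrite add0r.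
have de : 0 < (d * e)^-1 by rewrite invr_gt0 mulr_gt0.
have [k kP] := nachbin_directed j j (d * e)^-1.
have := fU [set g | forall y, V k y * modulus ((g : ns) y) <= 1].
have fk : nbhs (0 : nachbin_space)
    [set g | forall y, V k y * modulus ((g : ns) y) <= 1].
  by apply/nachbin_nbhs0P; exists k.
move=> /(_ fk y); have [h _] := kP y.
have {jd} jd : d <= V j y by exact: nbhs_singleton jd.
move=> fy; rewrite -(ler_pM2l d0).
have : (d * e)^-1 * (d * modulus ((f : ns) y)) <= 1.
  rewrite (le_trans _ fy)// mulrA ler_wpM2r ?modulus_ge0// (le_trans _ h)//.
  by rewrite ler_wpM2l// ltW.
by rewrite ler_pdivrMl ?mulr_gt0// mulr1.
Qed.

(** A Cauchy filter converges pointwise, and uniformly for every weight; the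
    limit is continuous since every point has a neighbourhood on which some
    weight is bounded away from 0. *)
Lemma nachbin_complete : tvs_complete nachbin_space.
Proof.
move=> F PF Fcauchy.
have cauchy_norm j (e : R) : 0 < e -> exists2 A : set nachbin_space, F A &
    forall f g : ns, A f -> A g ->
      forall y, V j y * modulus (f y - g y) <= e.
  move=> e0; have [k kP] := nachbin_directed j j e^-1.
  have [|A FA Ae] := Fcauchy [set f | forall y,
      V k y * modulus ((f : ns) y) <= 1].
    by apply/nachbin_nbhs0P; exists k.
  exists A => // f g Af Ag y; have [h _] := kP y.
  rewrite -[leRHS]mulr1 -ler_pdivrMl// mulrA.
  apply: le_trans (Ae _ _ Af Ag y); by rewrite ler_wpM2r ?modulus_ge0.
have lim y : exists l : K, forall e : R, 0 < e ->
    \forall f \near F, modulus (l - (f : ns) y) < e.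
  apply: (@scalars_complete R c _ F
    (fun f : ns => (f : ns) y) PF) => e e0.
  have [j [d d0 jd]] := nachbin_locally_positive V y.
  have {jd} jd : d <= V j y by exact: nbhs_singleton jd.
  have de : 0 < d * (e / 2) by rewrite mulr_gt0// divr_gt0.
  have [A FA Ae] := cauchy_norm j _ de; exists A => // f g Af Ag.
  rewrite (@le_lt_trans _ _ (e / 2))//; last by rewrite ltr_pdivrMr// ltr_pMr// ltr1n.
  rewrite -(ler_pM2l d0) (le_trans _ (Ae f g Af Ag y))//.
  by rewrite ler_wpM2r ?modulus_ge0.
have [f fP] := choice lim.
(* The Cauchy estimates pass to the pointwise limit f. *)
have uniform j (e : R) : 0 < e -> exists2 A : set nachbin_space, F A &
    forall g : ns, A g ->
      forall y, V j y * modulus (f y - g y) <= e.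
  move=> e0; have [A FA Ae] := cauchy_norm j e e0; exists A => // g Ag y.
  apply/ler_addgt0Pr => d d0.
  have dV : 0 < d / (V j y + 1) by rewrite divr_gt0// ltr_wpDl.
  have [h [Ah hy]] := filter_ex (filterI FA (fP y _ dV)).
  rewrite (le_trans (ler_wpM2l (V0 j y) (modulusBD _ ((h : ns) y) _)))//.
  rewrite mulrDr addrC lerD//; first exact: Ae.
  rewrite (le_trans (ler_wpM2l (V0 j y) (ltW hy)))// mulrCA ger_pMr//.
  by rewrite ler_pdivrMr ?mul1r ?lerDl// ltr_wpDl.
have fc : continuous (f : Y -> K^o).
  move=> y; apply/modulus_cvgP => e e0.
  have [j [d d0 jd]] := nachbin_locally_positive V y.
  have de : 0 < d * (e / 4) by rewrite mulr_gt0// divr_gt0.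
  have [A FA Ae] := uniform j _ de.
  have [g Ag] := filter_ex FA.
  have gA := Ae g Ag.
  have e4 : 0 < e / 4 by rewrite divr_gt0.
  have /modulus_cvgP/(_ _ e4) gy := (linsub_in (g : ns)).1 y.
  have close z : d <= V j z -> modulus (f z - (g : ns) z) <= e / 4.
    by move=> dz; rewrite -(ler_pM2l d0) (le_trans _ (gA z))// ler_wpM2r ?modulus_ge0.
  have cy := close y (nbhs_singleton jd).
  near=> z.
  have cz : modulus (f z - (g : ns) z) <= e / 4.
    by apply: close; near: z.
  have gz : modulus ((g : ns) y -
                     (g : ns) z) < e / 4.
    by near: z.
  rewrite modulusB_sym in cz.
  have h1 := modulusBD (f y) ((g : ns) y) (f z).
  have h2 := modulusBD ((g : ns) y) ((g : ns) z) (f z).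
  by move: cy cz gz h1 h2; lra.
have fV j : vanishing (V j) (f : Y -> K^o).
  move=> e e0; have e2 : 0 < e / 2 by rewrite divr_gt0.
  have [A FA Ae] := uniform j _ e2; have [g Ag] := filter_ex FA.
  have [L Lc Lg] := (linsub_in (g : ns)).2 j _ e2.
  exists L => // y /Lg gy; rewrite (splitr e).
  apply: le_lt_trans (ler_ltD (Ae g Ag y) gy).
  rewrite -mulrDr ler_wpM2l//.
  by rewrite (le_trans _ (modulusD _ _))// subrK.
have fW : linsub_set nachbin_linsub f by split.
exists (linsub_elt fW : nachbin_space) => U /nbhs_translate/nachbin_nbhs0P[j jU].
have [A FA Ae] := uniform j 1 ltr01; apply: filterS FA => g Ag.
rewrite -(subrK (linsub_elt fW : nachbin_space) g) addrC; apply: jU => y /=.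
by rewrite modulusB_sym; exact: Ae.
Unshelve. all: by end_near. Qed.

Lemma nachbin_rescale (f : ns) (u : Y -> R) :
  continuous u -> (forall y, 0 <= u y <= 1) -> nachbin_set (rescale u f).
Proof.
move=> uc u01; have [fc fV] := linsub_in f; split.
  exact: rescale_continuous.
by move=> j; apply: vanishing_rescale.
Qed.

(** A set defined by pointwise bounds is closed, hence a Banach disc as soon
    as it is bounded. *)
Lemma pointwise_banach_disc (I : Type) (t : I -> Y -> R) :
  (forall i y, 0 <= t i y) ->
  (forall j, exists i M, forall y, V j y * t i y <= M) ->
  banach_disc ([set f | forall i y, modulus ((f : ns) y) <= t i y]
    : set nachbin_space).
Proof.
move=> t0 tV; apply: banach_disc_complete.
- split; first by move=> i y /=; rewrite modulus0.
  move=> a b f g ab ft gt i y /=.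
  rewrite (le_trans (modulusD _ _))// !modulusM.
  rewrite (@le_trans _ _ ((modulus a + modulus b) * t i y))//.
    by rewrite mulrDl lerD// ler_wpM2l ?modulus_ge0//; [exact: ft|exact: gt].
  by rewrite -[leRHS]mul1r ler_wpM2r.
- exact: nachbin_complete.
- move=> U /nachbin_nbhs0P[j jU]; have [i [M tM]] := tV j.
  exists (`|M| + 1); first by rewrite ltr_wpDl.
  move=> a aM f ft; have a0 : a != 0.
    by rewrite -modulus_gt0 (lt_le_trans _ aM)// ltr_wpDl.
  have ma : 0 < modulus a by rewrite modulus_gt0.
  exists (a^-1 *: f); last by rewrite scalerA mulfV// scale1r.
  apply: jU => y /=; rewrite modulusM.
  have aV : modulus a * modulus a^-1 = 1 by rewrite -modulusM mulfV// modulus1.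
  rewrite -[X in _ * (X * _)]/(modulus (a^-1 : K)).
  rewrite mulrCA -(ler_pM2l ma) !mulrA aV mul1r mulr1.
  rewrite (le_trans (ler_wpM2l (V0 j y) (ft i y)))// (le_trans (tM y))//.
  by rewrite (le_trans _ aM)// (le_trans (ler_norm _))// lerDl.
- move=> f ft i y; apply/ler_addgt0Pr => e e0.
  have [j [d d0 jd]] := nachbin_locally_positive V y.
  have {jd} jd : d <= V j y by exact: nbhs_singleton jd.
  have [k kP] := nachbin_directed j j (d * e)^-1.
  have [|g gt fg] := ft [set g | forall y, V k y * modulus ((g : ns) y) <= 1].
    by apply/nachbin_nbhs0P; exists k.
  have [h _] := kP y; have {fg} := fg y; rewrite /=.
  set z := modulus _ => kz.
  have : (d * e)^-1 * (d * z) <= 1.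
    rewrite (le_trans _ kz)// mulrA ler_wpM2r ?modulus_ge0// (le_trans _ h)//.
    by rewrite ler_wpM2l// invr_ge0 mulr_ge0// ltW.
  rewrite ler_pdivrMl ?mulr_gt0// mulr1 ler_pM2l// => ze.
  have := modulusD ((f : ns) y - (g : ns) y) ((g : ns) y).
  rewrite subrK => /le_trans; apply; rewrite addrC; apply: lerD => //.
Qed.

End NachbinSpace.

(** * Slicing a function by truncation *)

Section Truncation.
Context {R : realType} {c : scalar_kind} {Y : topologicalType}.
Local Notation K := (scalars R c).
Implicit Types (T : Y -> R) (f : Y -> K^o).

(** Multiplication by this factor replaces the modulus of f by its minimum
    with T, in a continuous way. *)
Definition truncation T f (y : Y) : R := T y / Num.max (T y) (modulus (f y)).

Let max_gt0 (a b : R) : 0 < a -> 0 < Num.max a b.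
Proof. by move=> a0; rewrite lt_max a0. Qed.

Lemma truncation_continuous T f : (forall y, 0 < T y) -> continuous T ->
  continuous f -> continuous (truncation T f).
Proof.
move=> T0 Tc fc; apply: continuous_div => //; last by move=> y; exact: max_gt0.
apply: continuous_maxr => // y.
by apply: continuous_comp; [exact: fc|exact: modulus_continuous].
Qed.

Lemma truncation01 T f y : 0 < T y -> 0 <= truncation T f y <= 1.
Proof.
move=> T0; have m0 := max_gt0 (modulus (f y)) T0.
by rewrite divr_ge0 ?(ltW T0) ?(ltW m0)//= ler_pdivrMr// mul1r le_max lexx.
Qed.

Lemma truncation_modulus T f y : 0 < T y ->
  truncation T f y * modulus (f y) = Num.min (T y) (modulus (f y)).
Proof.
move=> T0; rewrite /truncation; case: leP => h; last by rewrite divff ?mul1r// gt_eqF.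
by rewrite mulfVK// gt_eqF// (lt_le_trans T0).
Qed.

Lemma truncation_eq1 T f y : 0 < T y -> modulus (f y) <= T y ->
  truncation T f y = 1.
Proof. by move=> T0 fT; rewrite /truncation max_l// divff// gt_eqF. Qed.

Lemma truncation_le S T f y : 0 < S y -> S y <= T y ->
  truncation S f y <= truncation T f y.
Proof.
move=> S0 ST; have T0 : 0 < T y by exact: lt_le_trans ST.
rewrite /truncation ler_pdivrMr ?max_gt0// mulrAC ler_pdivlMr ?max_gt0//.
have m0 := modulus_ge0 (f y).
case: (leP (T y) (modulus (f y))) => h1; case: (leP (S y) (modulus (f y))) => h2.
- by rewrite ler_wpM2r.
- by move: ST h1 h2; lra.
- by rewrite mulrC ler_wpM2l// ltW.
- by rewrite mulrC.
Qed.

End Truncation.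

Section Decomposition.
Context {R : realType} {c : scalar_kind}.
Local Notation K := (scalars R c).

Lemma dyadic_le1 k m : (k <= m)%N -> 2 ^+ k * 2^-1 ^+ m <= 1 :> R.
Proof.
move=> km; rewrite exprVn ler_pdivrMr ?exprn_gt0// mul1r.
by rewrite ler_weXn2l// ler1n.
Qed.

Lemma absolutely_convex_dyadic (E : lmodType K) (A : set E) (g : nat -> E) m :
  absolutely_convex A -> (forall i, A (g i)) ->
  A (\sum_(i < m) real_scalar (2^-1 ^+ i.+1) *: g i).
Proof.
move=> Ac; elim: m g => [|m IH] g Ag; first by rewrite big_ord0; exact: Ac.1.
rewrite big_ord_recl.
have -> : \sum_(i < m) real_scalar (2^-1 ^+ (lift ord0 i).+1) *: g (lift ord0 i) =
    real_scalar 2^-1 *: \sum_(i < m) real_scalar (2^-1 ^+ i.+1) *: g i.+1.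
  rewrite scaler_sumr; apply: eq_bigr => i _.
  by rewrite scalerA -real_scalarM -exprS.
apply: Ac.2; [|exact: Ag|by apply: (IH (fun i => g i.+1)) => i; exact: Ag].
by rewrite expr1 modulus_real ?invr_ge0//; lra.
Qed.

(** f is cut into finitely many slices: the i-th one is the part of f of
    modulus between the sums of the first i and i + 1 bounds. Compactness of L
    turns the pointwise bounds by single t i into a bound by a finite sum, and
    off L the first slice exhausts f, so that the others have compact
    support. *)
Lemma slice_decomposition (Y : topologicalType) (A : set (Y -> K^o))
    (t : nat -> Y -> R) (f : Y -> K^o) (L : set Y) :
  absolutely_convex A -> (forall i y, 0 < t i y) ->
  (forall i, continuous (t i)) -> continuous f -> compact L ->
  (forall y, ~ L y -> modulus (f y) <= t 0%N y) ->
  (forall y, L y -> exists n, modulus (f y) < t n y) ->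
  (forall i (u : Y -> R), continuous u -> (forall y, 0 <= u y <= 1) ->
    (forall y, u y * modulus (f y) <= t i y) ->
    ((0 < i)%N -> forall y, ~ L y -> u y = 0) ->
    A (real_scalar (2 ^+ i.+1) *: rescale u f)) ->
  A f.
Proof.
move=> Ac t0 tc fc Lc fL fn fA.
pose T m y := \sum_(i < m) t i y.
have TS m y : T m.+1 y = T m y + t m y by rewrite /T big_ord_recr.
have T_ge0 m y : 0 <= T m y by rewrite sumr_ge0// => i _; exact: ltW.
have T0 m y : 0 < T m.+1 y by rewrite TS ltr_wpDl.
have Tc m : continuous (T m) by exact: continuous_seq_sum.
have T_le m n y : (m <= n)%N -> T m y <= T n y.
  elim: n => [|n IH]; first by rewrite leqn0 => /eqP ->.
  rewrite leq_eqVlt => /predU1P[->//|/IH /le_trans]; apply.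
  by rewrite TS lerDl ltW.
have t_le m n y : (m < n)%N -> t m y <= T n y.
  by move=> /(T_le _ _ y); apply: le_trans; rewrite TS lerDr.
have [m fT] : exists m, forall y, modulus (f y) <= T m.+1 y.
  have /compact_near_coveringP Ln := Lc.
  have [|n _ nL] := Ln _ \oo (fun n y => modulus (f y) < T n y) _.
    move=> y /fn[n yn].
    have yz : \forall z \near y, 0 < t n z - modulus (f z).
      have e0 : 0 < t n y - modulus (f y) by rewrite subr_gt0.
      have gc : (fun z => t n z - modulus (f z)) z @[z --> y] --> t n y - modulus (f y).
        apply: cvgB; first exact: tc.
        by apply: continuous_comp; [exact: fc|exact: modulus_continuous].
      move/cvgrPdist_lt : gc => /(_ _ e0); apply: filterS => z /=.
      by rewrite ltr_norml => /andP[_]; lra.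
    exists ([set z | 0 < t n z - modulus (f z)], [set k | (n < k)%N]).
      by split => //; exists n.+1.
    move=> [z k] [/= nz nk]; rewrite subr_gt0 in nz.
    exact: lt_le_trans nz (t_le _ _ _ nk).
  exists n => y; have [Ly|Ly] := pselect (L y).
    exact/ltW/(nL n.+1)/Ly/leqW.
  by rewrite (le_trans (fL y Ly))// t_le.
pose u n := if n is k.+1 then truncation (T k.+1) f else fun=> 0.
have uc n : continuous (u n).
  case: n => [y|n]; first exact: cvg_cst.
  exact: truncation_continuous.
have uf n y : u n y * modulus (f y) = Num.min (T n y) (modulus (f y)).
  case: n => [|n]; last exact: truncation_modulus.
  by rewrite mul0r /T big_ord0 min_l// modulus_ge0.
have u_le n y : u n y <= u n.+1 y.
  case: n => [|n] /=; first by have /andP[] := truncation01 f (T0 0%N y).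
  by apply: truncation_le => //; exact: T_le.
have u01 n y : 0 <= u n y <= 1.
  by case: n => [|n] /=; [rewrite lexx ler01|exact: truncation01].
pose v n y := u n.+1 y - u n y.
have v01 n y : 0 <= v n y <= 1.
  by move: (u_le n y) (u01 n y) (u01 n.+1 y); rewrite /v; lra.
have vf n y : v n y * modulus (f y) <= t n y.
  rewrite mulrBl !uf TS; move: (ltW (t0 n y)) (T_ge0 n y) => tn Tn.
  by case: (leP (T n y) (modulus (f y))) => h1;
    case: (leP (T n y + t n y) (modulus (f y))) => h2; lra.
have vc n : continuous (v n).
  by move=> y; apply: cvgB; exact: uc.
have -> : f = \sum_(i < m.+1) real_scalar (2^-1 ^+ i.+1) *:
    (real_scalar (2 ^+ i.+1) *: rescale (v i) f).
  apply/funext => y; rewrite fct_sumE.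
  transitivity (\sum_(i < m.+1) real_scalar (v i y) * f y).
    rewrite -mulr_suml.
    have -> : \sum_(i < m.+1) real_scalar (v i y) = real_scalar (u m.+1 y - u 0%N y) :> K.
      elim: m.+1 => [|n IH]; first by rewrite big_ord0 subrr real_scalar0.
      by rewrite big_ord_recr/= IH -real_scalarD /v addrC addrA subrK.
    by rewrite subr0 /= truncation_eq1// real_scalar1 mul1r.
  apply: eq_bigr => i _; rewrite scalerA -real_scalarM -exprMn mulVf ?expr1n//.
  by rewrite real_scalar1 scale1r.
apply: (absolutely_convex_dyadic
  (g := fun i => real_scalar (2 ^+ i.+1) *: rescale (v i) f)) => // i.
apply: fA => // i0 y /fL fy; case: i i0 => // i _.
have fT1 k : modulus (f y) <= T k.+1 y by apply: le_trans fy (t_le _ _ _ _).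
by rewrite /v /= !truncation_eq1 ?subrr.
Qed.

End Decomposition.

(** * The topology of the inductive limit *)

Section Subordinate.
Context {R : realType} {Y : topologicalType}.

Lemma weight_compact_bounded (a : weight R Y) (L : set Y) : compact L ->
  exists M, forall y, L y -> a y <= M.
Proof.
move=> Lc; have [|M aM] := @compact_modulus_bounded R RealScalars Y a L _ Lc.
  exact: weight_continuous.
by exists M => y /aM; apply: le_trans; exact: ler_norm.
Qed.

Context (v : decreasing_weights R Y).

Lemma dec_weight_le m n y : (m <= n)%N -> v n y <= v m y.
Proof.
elim: n => [|n IH]; first by rewrite leqn0 => /eqP ->.
rewrite leq_eqVlt => /predU1P[->//|/IH]; apply: le_trans.
exact: dec_weightP.
Qed.

(** The maximal Nachbin family of the sequence v. *)
Definition subordinate (w : Y -> R) :=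
  (forall y, 0 <= w y) /\ forall n, exists M, forall y, w y <= M * v n y.

Lemma subordinateD w w' : subordinate w -> subordinate w' ->
  subordinate (fun y => w y + w' y).
Proof.
move=> [w0 wv] [w'0 w'v]; split=> [y|n]; first by rewrite addr_ge0.
have [M wM] := wv n; have [M' wM'] := w'v n; exists (M + M') => y.
by rewrite mulrDl lerD.
Qed.

Lemma subordinateZ (M : R) w : 0 <= M -> subordinate w ->
  subordinate (fun y => M * w y).
Proof.
move=> M0 [w0 wv]; split=> [y|n]; first by rewrite mulr_ge0.
have [M' wM'] := wv n; exists (M * M') => y.
by rewrite -mulrA ler_wpM2l.
Qed.

Lemma subordinate_tail w m : (forall y, 0 <= w y) ->
  (forall n, (m <= n)%N -> exists M, forall y, w y <= M * v n y) ->
  subordinate w.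
Proof.
move=> w0 wv; split=> // n; have [M wM] := wv _ (leq_maxr n m).
have v0 k y : 0 < v k y by exact: weight_gt0.
exists `|M| => y; rewrite (le_trans (wM y))//.
rewrite (@le_trans _ _ (`|M| * v (maxn n m) y))//.
  by rewrite ler_wpM2r ?ler_norm// ltW.
by rewrite ler_wpM2l// dec_weight_le// leq_maxl.
Qed.

Lemma subordinate_compact (L : set Y) : compact L ->
  subordinate (fun y => (y \in L)%:R).
Proof.
move=> Lc; split=> // n.
have [M vM] := weight_compact_bounded (inverse_weight (v n)) Lc.
have v0 y : 0 < v n y by exact: weight_gt0.
exists `|M| => y; have [|] := boolP (y \in L); last first.
  by move=> _; rewrite mulr_ge0// ltW.
rewrite inE => /vM /=; rewrite -ler_pdivrMr// mul1r => /le_trans; apply.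
exact: ler_norm.
Qed.

Lemma subordinate_inf (C : nat -> R) : (forall n, 0 < C n) -> exists w,
  subordinate w /\ forall y r, (forall n, r <= C n * v n y) -> r <= w y.
Proof.
move=> C0; pose w y := inf [set C n * v n y | n in [set: nat]].
have v0 n y : 0 < C n * v n y by rewrite mulr_gt0// weight_gt0.
have inf_le n y : w y <= C n * v n y.
  by apply: ge_inf; [exists 0 => _ [k _ <-]; exact: ltW|exists n].
have le_w y r : (forall n, r <= C n * v n y) -> r <= w y.
  move=> rC; apply: lb_le_inf; first by exists (C 0%N * v 0%N y), 0%N.
  by move=> _ [k _ <-].
exists w; split => //; split=> [y|n]; last by exists (C n).
by apply: le_w => n; exact: ltW.
Qed.

(** The infimum need not be attained: the room left by the strict inequality
    is what singles out one n. *)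
Lemma subordinate_inf_lt (C : nat -> R) (w : Y -> R) y (r : R) :
  (forall n, 0 < C n) ->
  (forall s, (forall n, s <= C n * v n y) -> s <= w y) ->
  0 <= r -> w y * r < 1 -> exists n, r < (C n * v n y)^-1.
Proof.
move=> C0 le_w r0 wr; apply/not_existsP => rn.
have v0 n : 0 < C n * v n y by rewrite mulr_gt0// weight_gt0.
have rC n : (C n * v n y)^-1 <= r by rewrite leNgt; apply/negP/rn.
have rpos : 0 < r by rewrite (lt_le_trans _ (rC 0%N))// invr_gt0.
have : r^-1 <= w y.
  by apply: le_w => n; rewrite -[leRHS]invrK lef_pV2 ?posrE ?invr_gt0.
by rewrite -div1r ler_pdivrMr// leNgt wr.
Qed.

End Subordinate.

Section C0Neighbourhoods.
Context {R : realType} {c : scalar_kind} {Y : topologicalType}.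
Local Notation K := (scalars R c).
Context {J : Type} (a : J -> weight R Y).

Lemma C0_nbhs0 (U : set (C0 c a)) : nbhs (0 : C0 c a) U ->
  exists s : seq J, exists2 d : R, 0 < d &
    forall f : linsub_type (C0_linsub c a),
      (forall y, (\sum_(j <- s) a j y) * modulus (f y) <= d) -> U f.
Proof.
move=> [s [e e0 sU]]; have s0 : 0 < (size s).+1%:R :> R by rewrite ltr0n.
have d0 : 0 < e / (size s).+1%:R by rewrite divr_gt0.
exists s, (e / (size s).+1%:R) => // f.
set d := e / _ in d0 *.
suff le_size t : (forall y, (\sum_(j <- t) a j y) * modulus (f y) <= d) ->
    seminorm_sum (C0_seminorm c a) t f <= (size t)%:R * d.
  move=> /le_size fs; apply: sU; rewrite /seminormed_ball/= subr0.
  rewrite (le_lt_trans fs)// /d mulrCA gtr_pMr//.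
  by rewrite ltr_pdivrMr// mul1r ltr_nat.
have a0 j y : 0 <= a j y by exact/ltW/weight_gt0.
elim: t => [|j t IH] ft; first by rewrite /seminorm_sum big_nil mul0r.
rewrite /seminorm_sum big_cons /= -natr1 mulrDl mul1r addrC lerD//.
  apply: IH => y; apply: le_trans (ft y).
  by rewrite big_cons ler_wpM2r ?modulus_ge0// lerDr.
apply: weighted_sup_le => [|y _]; first exact: ltW.
apply: le_trans (ft y); rewrite big_cons ler_wpM2r ?modulus_ge0// lerDl.
by rewrite sumr_ge0.
Qed.

Lemma C0_rescale (f : Y -> K^o) (u : Y -> R) : continuous u ->
  (forall y, 0 <= u y <= 1) -> C0_set a f -> C0_set a (rescale u f).
Proof.
move=> uc u01 [fc fa]; split; first exact: rescale_continuous.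
move=> j e /(fa j)[L Lc Lf]; exists L => // y /Lf; apply: le_lt_trans.
have ay : 0 <= a j y by exact/ltW/weight_gt0.
have /andP[u0 u1] := u01 y; rewrite modulus_rescale//.
rewrite !ger0_norm ?mulr_ge0 ?modulus_ge0//.
by rewrite mulrCA -[leRHS]mul1r ler_wpM2r// mulr_ge0 ?modulus_ge0.
Qed.

Lemma C0_scale (f : Y -> K^o) (k : K) : C0_set a f -> C0_set a (k *: f).
Proof.
move=> fa; have := C0_closed k fa (C0_zero c a).
by rewrite addr0.
Qed.

Lemma C0_compact_support (f : Y -> K^o) (L : set Y) : continuous f ->
  compact L -> (forall y, ~ L y -> f y = 0) -> C0_set a f.
Proof.
move=> fc Lc fL; split=> // j e e0; exists L => // y /fL ->.
by rewrite modulus0 mulr0 normr0.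
Qed.

End C0Neighbourhoods.

Section StepSpaces.
Context {R : realType} {c : scalar_kind} {Y : topologicalType}.
Local Notation K := (scalars R c).
Context (v : decreasing_weights R Y).
Local Notation V0C := (V0C c v).
Local Notation elt := (linsub_type (V0C_linsub c v)).

Lemma V0C_vanishing (f : elt) w : subordinate v w -> vanishing w f.
Proof.
case=> w0 wv; have [n [fc fn]] := linsub_in f; have [M wM] := wv n.
apply: (@vanishing_le _ _ _ (v n) w M) => [y|y|e e0]; first exact/ltW/weight_gt0.
  exact: wM.
have [L Lc Lf] := fn tt e e0; exists L => // y /Lf.
by rewrite ger0_norm// mulr_ge0 ?modulus_ge0// ltW// weight_gt0.
Qed.

Lemma V0C_continuous (f : elt) : continuous (f : Y -> K^o).
Proof. by have [n []] := linsub_in f. Qed.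

Lemma nbhs0_step (U : set V0C) n : nbhs (0 : V0C) U ->
  exists2 d : R, 0 < d &
    forall f : elt, C0_set (fun _ : unit => v n) (f : Y -> K^o) ->
      (forall y, v n y * modulus (f y) <= d) -> U f.
Proof.
move=> [s [e e0 sU]].
suff [d d0 dP] : exists2 d : R, 0 < d &
    forall f : elt, C0_set (fun _ : unit => v n) (f : Y -> K^o) ->
      (forall y, v n y * modulus (f y) <= d) ->
      seminorm_sum (fun p : {p : seminorm (linsub_type (V0C_linsub c v)) |
        forall n, continuous (p \o V0C_incl c v n)} => sval p) s f < e.
  exists d => // f fn fd; apply: sU; rewrite /seminormed_ball/= subr0.
  exact: dP.
elim: s e e0 {sU} => [|p s IH] e e0.
  by exists 1 => // f _ _; rewrite /seminorm_sum big_nil.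
have e2 : 0 < e / 2 by rewrite divr_gt0.
have [d d0 dP] := IH _ e2.
have p0 : nbhs (0 : C0 c (fun _ : unit => v n))
    [set g | sval p (V0C_incl c v n g) < e / 2].
  have /cvgrPdist_lt/(_ _ e2) := svalP p n (0 : C0 c (fun _ : unit => v n)).
  apply: filterS => g /=; rewrite linear0 seminorm0 sub0r normrN.
  by rewrite ger0_norm// seminorm_ge0.
have [t [r r0 tr]] := C0_nbhs0 p0.
have t1 : 0 < (size t)%:R + 1 :> R by rewrite ltr_wpDl.
exists (Num.min d (r / ((size t)%:R + 1))); first by rewrite lt_min d0 divr_gt0.
move=> f fn fd; rewrite /seminorm_sum big_cons (splitr e); apply: ltrD; last first.
  by apply: dP => // y; move: (fd y); rewrite le_min => /andP[].
pose g := @linsub_elt _ _ (C0_linsub c (fun _ : unit => v n)) (f : Y -> K^o) fn.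
have := tr g; rewrite /=.
have -> : V0C_incl c v n g = f by exact: val_inj.
apply=> y; move: (fd y); rewrite le_min => /andP[_].
rewrite ler_pdivlMr// => /(le_trans _); apply.
rewrite big_const_seq count_predT iter_addr_0 -[X in X * _]mulr_natr.
rewrite mulrAC ler_wpM2l ?mulr_ge0 ?modulus_ge0//; last by rewrite lerDl.
exact/ltW/weight_gt0.
Qed.

Lemma seminormed_ball_absolutely_convex (E : lmodType K) (I : Type)
    (p : I -> seminorm E) s e : 0 < e ->
  absolutely_convex (seminormed_ball (p := p) s e (0 : E)).
Proof.
move=> e0; rewrite /seminormed_ball; split.
  by rewrite /= subrr seminorm_sum0.
move=> a b x y ab /=; rewrite !subr0 => xe ye.
rewrite (le_lt_trans (seminorm_sumD _ _ _ _))// !seminorm_sumZ.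
have p0 z := seminorm_sum_ge0 p s z.
have m := modulus_ge0 (a : K); have m' := modulus_ge0 (b : K).
pose q := Num.max (seminorm_sum p s x) (seminorm_sum p s y).
rewrite (@le_lt_trans _ _ ((modulus a + modulus b) * q))//.
  by rewrite mulrDl lerD// ler_wpM2l// le_max lexx ?orbT.
rewrite (@le_lt_trans _ _ q)//; last by rewrite gt_max xe ye.
by rewrite -[leRHS]mul1r ler_wpM2r// le_max p0.
Qed.

(** A neighbourhood of 0 contains a multiple of the unit ball of every step.
    If w is the infimum of the corresponding multiples of the v n, a function
    bounded by the reciprocal of w is cut into slices, each of them small in
    a step of its own. *)
Lemma V0C_nbhs0 (U : set V0C) : nbhs (0 : V0C) U ->
  exists2 w, subordinate v w &
    forall f : elt, (forall y, w y * modulus (f y) <= 1) -> U f.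
Proof.
move=> [s [e e0 sU]].
set B := seminormed_ball s e (0 : V0C) in sU.
have B0 : nbhs (0 : V0C) B by exists s, e.
have Bc : absolutely_convex B by exact: seminormed_ball_absolutely_convex.
have /choice[d dP] : forall n, exists d, 0 < d /\
    forall f : elt, C0_set (fun _ : unit => v n) (f : Y -> K^o) ->
      (forall y, v n y * modulus (f y) <= d) -> B f.
  by move=> n; have [r r0 rP] := nbhs0_step n B0; exists r.
(* The slice for the step n is the one of index n + 1, which slicing multiplies
   by 2 ^ (n + 2). *)
pose C n := (2^-1 ^+ n.+2 * d n)^-1.
have C0 n : 0 < C n.
  by rewrite invr_gt0 mulr_gt0 ?exprn_gt0 ?invr_gt0//; have [] := dP n.
have [w [wv le_w]] := subordinate_inf v C0.
exists (fun y => 2 * w y); first exact: subordinateZ.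
move=> f fw; apply: sU.
pose A : set (Y -> K^o) := [set g | exists2 h : elt, B h & (h : Y -> K^o) = g].
suff [h Bh hf] : A f by have <- : h = f by exact: val_inj.
pose t n y := (C n * v n y)^-1.
have v0 n y : 0 < v n y by exact: weight_gt0.
have t0 n y : 0 < t n y by rewrite invr_gt0 mulr_gt0.
have tv n k y : (k <= n.+2)%N -> v n y * (2 ^+ k * t n y) <= d n.
  move=> kn; have [dn _] := dP n.
  have -> : v n y * (2 ^+ k * t n y) = 2 ^+ k * 2^-1 ^+ n.+2 * d n.
    rewrite /t invfM /C invrK (mulrC _ (v n y)^-1) !mulrA.
    by rewrite [_ * _ / v n y]mulrAC mulfV ?gt_eqF// mul1r.
  by rewrite ger_pMl//; exact: dyadic_le1.
have tc n : continuous (t n).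
  move=> y; apply: cvgV; first by rewrite gt_eqF// mulr_gt0.
  by apply: cvgM; [exact: cvg_cst|exact: weight_continuous].
have [n0 [fc fn0]] := linsub_in f.
have [|L Lc Lf] := fn0 tt (C n0)^-1; first by rewrite invr_gt0.
(* The step n0 containing f comes first and takes f at infinity; the other
   slices have compact support and so belong to every step. *)
pose t' i := if i is k.+1 then t k else t n0.
apply: (slice_decomposition (t := t') (L := L)) => //.
- split; first by exists 0 => //; exact: Bc.1.
  move=> a b _ _ ab [g Bg <-] [h Bh <-].
  exists (a *: g + b *: h); first exact: Bc.2.
  by rewrite linsub_funD !linsub_funZ.
- by move=> [|i] y; exact: t0.
- by move=> [|i]; exact: tc.
- move=> y /Lf; rewrite ger0_norm ?mulr_ge0 ?modulus_ge0 ?(ltW (v0 _ _))//.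
  by move=> /ltW fy; rewrite /t' /t invfM ler_pdivlMr// mulrC.
- move=> y _; have [|n fn] := subordinate_inf_lt C0 (le_w y) (modulus_ge0 (f y)).
    by move: (fw y); rewrite -mulrA; lra.
  by exists n.+1.
move=> i u uc u01 ut uL.
have bnd n k : (k <= n.+2)%N -> (forall y, u y * modulus (f y) <= t n y) ->
    forall y, v n y * modulus ((real_scalar (2 ^+ k) *: rescale u f) y) <= d n.
  move=> kn un y; rewrite modulusM modulus_real ?exprn_ge0//.
  rewrite modulus_rescale; last by case/andP: (u01 y).
  apply: le_trans (tv n k y kn); rewrite ler_wpM2l ?(ltW (v0 _ _))//.
  by rewrite ler_wpM2l ?exprn_ge0.
have step_A n (g : Y -> K^o) : C0_set (fun _ : unit => v n) g ->
    (forall y, v n y * modulus (g y) <= d n) -> A g.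
  move=> gn gd; have gV : V0C_set v g by exists n.
  pose h : elt := @linsub_elt _ _ (V0C_linsub c v) g gV.
  by exists h => //; apply: (dP n).2.
case: i ut uL => [|i] ut uL; [apply: (step_A n0)|apply: (step_A i)].
- by apply/C0_scale/C0_rescale.
- exact: bnd.
- apply: C0_scale; apply: C0_compact_support Lc _.
    exact: rescale_continuous.
  by move=> y Ly; rewrite /rescale/= uL// real_scalar0 mul0r.
- exact: bnd.
Qed.

End StepSpaces.

(** * The function space on the product *)

Section ProductSpace.
Context {R : realType} {X1 X2 : topologicalType}.
Hypothesis lc2 : locally_compact [set: X2].
Context (a : increasing_weights R X1) (v : decreasing_weights R X2).

Lemma inc_weight_le m n x : (m <= n)%N -> a m x <= a n x.
Proof.
elim: n => [|n IH]; first by rewrite leqn0 => /eqP ->.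
rewrite leq_eqVlt => /predU1P[->//|/IH] /le_trans; apply.
exact: inc_weightP.
Qed.

Let a0 n x : 0 < a n x. Proof. exact: weight_gt0. Qed.
Let v0 n y : 0 < v n y. Proof. exact: weight_gt0. Qed.

Definition tensor_weight (b : X1 -> R) (w : X2 -> R) (z : X1 * X2) : R :=
  b z.1 * w z.2.

Lemma tensor_weight_continuous (b : X1 -> R) (w : X2 -> R) :
  continuous b -> continuous w -> continuous (tensor_weight b w).
Proof.
move=> bc wc z; apply: cvgM.
  by apply: (@continuous_comp _ _ _ fst b); [exact: cvg_fst|exact: bc].
by apply: (@continuous_comp _ _ _ snd w); [exact: cvg_snd|exact: wc].
Qed.

Lemma tensor_weight_gt0 N n z : 0 < tensor_weight (a N) (v n) z.
Proof. by rewrite mulr_gt0. Qed.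

Local Notation index := (nat * {w : X2 -> R | subordinate v w})%type.

Definition product_weight (i : index) : X1 * X2 -> R :=
  tensor_weight (a i.1) (sval i.2).

Let sub0 (i : index) y : 0 <= sval i.2 y.
Proof. by have [] := svalP i.2. Qed.

Let product_weight_ge0 i z : 0 <= product_weight i z.
Proof. by rewrite mulr_ge0// ltW. Qed.

Let product_weight_bounded i L : compact L ->
  exists M, forall z, L z -> product_weight i z <= M.
Proof.
move=> Lc; have [_ /(_ 0%N)[M wM]] := svalP i.2.
pose b := @Weight R (X1 * X2)%type (tensor_weight (a i.1) (v 0%N))
  (tensor_weight_gt0 _ _) (tensor_weight_continuous (@weight_continuous _ _ _)
    (@weight_continuous _ _ _)).
have [M' bM] := weight_compact_bounded b Lc.
exists (`|M| * M') => z /bM bz.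
rewrite (@le_trans _ _ (`|M| * b z))//; last by rewrite ler_wpM2l.
rewrite /product_weight /= /tensor_weight mulrCA ler_pM2l//.
by rewrite (le_trans (wM z.2))// ler_wpM2r ?ler_norm// ltW.
Qed.

Let product_weight_directed (i j : index) (M : R) : exists k : index, forall z,
  M * product_weight i z <= product_weight k z /\
  product_weight j z <= product_weight k z.
Proof.
have kP := subordinateD (subordinateZ (normr_ge0 M) (svalP i.2)) (svalP j.2).
exists (maxn i.1 j.1, exist _ _ kP) => z.
rewrite /product_weight /tensor_weight /=.
have i0 := sub0 i z.2; have j0 := sub0 j z.2.
have ai : a i.1 z.1 <= a (maxn i.1 j.1) z.1 by rewrite inc_weight_le// leq_maxl.
have aj : a j.1 z.1 <= a (maxn i.1 j.1) z.1 by rewrite inc_weight_le// leq_maxr.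
split; last by rewrite ler_pM ?(ltW (a0 _ _))// lerDr mulr_ge0.
have ak : 0 <= a (maxn i.1 j.1) z.1 by exact: ltW.
apply: (@le_trans _ _ (`|M| * (a (maxn i.1 j.1) z.1 * sval i.2 z.2))).
  apply: (@le_trans _ _ (`|M| * (a i.1 z.1 * sval i.2 z.2))).
    by rewrite ler_wpM2r ?ler_norm// mulr_ge0// ltW.
  by rewrite ler_wpM2l// ler_wpM2r.
by rewrite mulrCA ler_wpM2l// lerDl.
Qed.

Let product_weight_positive (z : (X1 * X2 : topologicalType)%type) : exists i, exists2 d, 0 < d &
  \forall y \near z, d <= product_weight i y.
Proof.
case: z => x y; have [L yL [Lc _]] := lc2 (I : [set: X2] y).
have {}yL : nbhs y L by move: yL; rewrite /within/=; apply: filterS => t; exact.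
exists (0%N, exist _ _ (subordinate_compact v Lc)), (a 0%N x / 2).
  by rewrite divr_gt0.
have ax : \forall x' \near x, a 0%N x / 2 <= a 0%N x'.
  have e0 : 0 < a 0%N x / 2 by rewrite divr_gt0.
  move/cvgrPdist_lt : (@weight_continuous _ _ (a 0%N) x) => /(_ _ e0).
  by apply: filterS => x'; rewrite ltr_norml => /andP[_]; lra.
exists ([set x' | a 0%N x / 2 <= a 0%N x'], L) => // -[x' y'] [/= ax' Ly'].
by rewrite /product_weight/tensor_weight/= mem_set// mulr1.
Qed.

Definition product_family : nachbin_family R (X1 * X2)%type :=
  @NachbinFamily R (X1 * X2)%type index product_weight
    (0%N, exist _ _ (subordinate_compact v compact0))
    product_weight_ge0 product_weight_bounded product_weight_directed
    product_weight_positive.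

Section Elements.
Context {c : scalar_kind}.
Local Notation K := (scalars R c).
Local Notation elt := (linsub_type (nachbin_linsub c product_family)).

Lemma product_vanishing (f : elt) N w : subordinate v w ->
  vanishing (tensor_weight (a N) w) f.
Proof. by move=> wv; exact: (linsub_in f).2 (N, exist _ w wv). Qed.

(** If f were unbounded in every step, the points witnessing it would make it
    unbounded for the infimum of suitable multiples of the weights v n. *)
Lemma product_bounded (f : elt) N : exists n M, forall z,
  tensor_weight (a N) (v n) z * modulus (f z) <= M.
Proof.
apply/not_existsP => unbounded.
have /choice[z zP] : forall n : nat, exists z,
    n%:R < tensor_weight (a N) (v n) z * modulus (f z).
  move=> n; apply/not_existsP => nz; apply: (unbounded n); exists n%:R => z.
  by rewrite leNgt; apply/negP/nz.
pose y n := (z n).2.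
(* The j-th term of the sum makes the infimum at y j at least v j (y j). *)
pose C n : R := 1 + \sum_(j < n) v j (y j) / v n (y j).
have C1 n : 1 <= C n.
  by rewrite lerDl sumr_ge0// => j _; rewrite divr_ge0// ltW.
have C0 n : 0 < C n by rewrite (lt_le_trans ltr01).
have [w [wv le_w]] := subordinate_inf v C0.
have wy j : v j (y j) <= w (y j).
  apply: le_w => n; have [jn|nj] := ltnP j n.
    rewrite -ler_pdivrMr// /C (bigD1 (Ordinal jn))//= addrCA lerDl.
    rewrite addr_ge0// sumr_ge0// => i _; by rewrite divr_ge0// ltW.
  rewrite (le_trans (dec_weight_le v (y j) nj))// ler_peMl//.
  exact: ltW.
have [fc _] := linsub_in f.
have [M fM] := @vanishing_bounded R c _ (product_weight (N, exist _ w wv)) f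
  (product_weight_ge0 _) (product_weight_bounded _) fc (product_vanishing f N wv).
have [n Mn] : exists n : nat, M <= n%:R.
  by exists (Num.bound `|M|); rewrite (le_trans (ler_norm _))// ltW// archi_boundP.
have : product_weight (N, exist _ w wv) (z n) * modulus (f (z n)) <= M.
  by apply: fM; exists (z n).
apply/negP; rewrite -ltNge (le_lt_trans Mn)// (lt_le_trans (zP n))//.
rewrite ler_wpM2r ?modulus_ge0//.
by rewrite /product_weight /tensor_weight /= ler_pM2l// wy.
Qed.

(** Where v m dominates a multiple of v n, regular decrease makes v n itself
    a subordinate weight; elsewhere v m is small compared to v n. *)
Lemma product_step (f : elt) N : regularly_decreasing v ->
  exists m, vanishing (tensor_weight (a N) (v m)) f.
Proof.
move=> vreg; have [n [M fM]] := product_bounded f N.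
have [m nm mP] := vreg n; exists m => e e0.
have M0 : 0 < `|M| + 1 by rewrite ltr_wpDl.
pose e' := e / (`|M| + 1); have e'0 : 0 < e' by rewrite divr_gt0.
pose S : set X2 := [set y | e' * v n y <= v m y].
pose w y := if y \in S then v n y else 0.
have wv : subordinate v w.
  apply: (subordinate_tail (m := m)) => [y|k mk].
    by rewrite /w; case: ifP => // _; exact: ltW.
  have [d d0 dP] := mP e' k e'0 mk; exists d^-1 => y; rewrite /w.
  case: ifPn => [|_]; last by rewrite mulr_ge0 ?invr_ge0 ?(ltW d0)// ltW.
  by rewrite inE => /dP yd; rewrite -ler_pdivrMl ?invr_gt0// invrK.
have [L Lc Lf] := product_vanishing f N wv e0.
exists L => // z Lz; have [Sz|Sz] := pselect (S z.2).
  apply: le_lt_trans (Lf z Lz); rewrite ler_wpM2r ?modulus_ge0//.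
  by rewrite /tensor_weight /w mem_set// ler_pM2l// dec_weight_le.
have {}Sz : v m z.2 < e' * v n z.2 by rewrite ltNge; apply/negP.
rewrite (@le_lt_trans _ _ (e' * (tensor_weight (a N) (v n) z * modulus (f z))))//.
  rewrite mulrA ler_wpM2r ?modulus_ge0// /tensor_weight mulrCA ler_pM2l//.
  exact: ltW.
rewrite (@le_lt_trans _ _ (e' * M))//; first by rewrite ler_pM2l.
by rewrite /e' mulrAC ltr_pdivrMr// ltr_pM2l// (le_lt_trans (ler_norm _))// ltrDl.
Qed.

End Elements.
End ProductSpace.

(** * Evaluations and the conditions on the weights *)

Section Evaluation.
Context {R : realType} {c : scalar_kind}.
Local Notation K := (scalars R c).

Lemma functional_continuous (E : tvsType K) (phi : {linear E -> K^o}) :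
  nbhs 0 [set x | modulus (phi x) <= 1] -> continuous phi.
Proof.
move=> phi1 x; apply/modulus_cvgP => e e0.
have e2 : 0 < e / 2 by rewrite divr_gt0.
have k0 : real_scalar (e / 2)^-1 != 0 :> K.
  by apply: real_scalar_neq0; rewrite invr_gt0.
apply/nbhs_translate; have := nbhs0_scale k0 phi1; apply: filterS => y /=.
rewrite linearZ /= [modulus _]modulusM modulus_real ?invr_ge0 ?(ltW e2)//.
rewrite ler_pdivrMl// mulr1 => ye.
rewrite linearD/= opprD addrA subrr sub0r modulusN (le_lt_trans ye)//.
by rewrite ltr_pdivrMr// ltr_pMr// ltr1n.
Qed.

Lemma seminorm_dist (E : lmodType K) (p : seminorm E) x y :
  `|p x - p y| <= p (x - y).
Proof.
have := seminormD p (x - y) y; have := seminormD p (y - x) x.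
rewrite !subrK -[p (y - x)]seminormN opprB => xy yx.
by rewrite ler_norml; apply/andP; split; lra.
Qed.

Section C0Evaluation.
Context {Y : topologicalType} {J : Type} (a : J -> weight R Y) (j : J).
Local Notation E := (C0 c a).

Definition C0_eval (k : K) (y : Y) (f : E) : K^o := k * linsub_fun f y.

Let C0_eval_linear k y : linear (C0_eval k y).
Proof.
move=> b f g; rewrite /C0_eval linsub_funD linsub_funZ mulrDr.
by congr (_ + _); rewrite [LHS]mulrCA.
Qed.

HB.instance Definition _ k y := GRing.isLinear.Build K E K^o _ (C0_eval k y)
  (C0_eval_linear k y).

Lemma C0_norm_ub (f : E) y : a j y * modulus (linsub_fun f y) <= C0_norms j f.
Proof.
exact: (weighted_sup_ub (C0_bounded j (linsub_in f)) (I : [set: Y] y)).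
Qed.

Lemma C0_norm_nbhs0 (r : R) : 0 < r -> nbhs (0 : E) [set f | C0_norms j f <= r].
Proof.
move=> r0; exists [:: j], r => // f; rewrite /seminormed_ball/= subr0.
by rewrite /seminorm_sum big_seq1 => /ltW.
Qed.

Lemma C0_eval_continuous k y : continuous (C0_eval k y).
Proof.
have ay : 0 < a j y by exact: weight_gt0.
have k1 : 0 < modulus k + 1 by rewrite ltr_wpDl// modulus_ge0.
apply: functional_continuous.
apply: filterS (C0_norm_nbhs0 (divr_gt0 ay k1)) => f /= fa.
have := le_trans (C0_norm_ub f y) fa.
rewrite ler_pM2l// -[(_ + 1)^-1]mul1r ler_pdivlMr// => fk.
rewrite modulusM (le_trans _ fk)// mulrC ler_wpM2l ?modulus_ge0//.
by rewrite lerDl.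
Qed.

Definition C0_delta k y : dual E := Dual (@C0_eval_continuous k y).

End C0Evaluation.

Section V0CEvaluation.
Context {Y : topologicalType} (v : decreasing_weights R Y).
Local Notation F := (V0C c v).
Local Notation elt := (linsub_type (V0C_linsub c v)).

(** The seminorm given by a subordinate weight is dominated on every step by
    a multiple of the norm of that step. *)
Lemma V0C_subordinate_nbhs w : subordinate v w ->
  nbhs (0 : F) [set f : elt | forall y, w y * modulus (f y) <= 1].
Proof.
move=> wv; have [w0 wn] := wv.
have wb L : compact L -> exists M, forall y, L y -> w y <= M.
  have [M wM] := wn 0%N => Lc; have [M' vM] := weight_compact_bounded (v 0%N) Lc.
  exists (`|M| * M') => y Ly; rewrite (le_trans (wM y))//.
  rewrite (@le_trans _ _ (`|M| * v 0%N y))//; last by rewrite ler_wpM2l// vM.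
  by rewrite ler_wpM2r ?ler_norm// ltW// weight_gt0.
have bounded (f : elt) : has_ubound [set w y * modulus (f y) | y in [set: Y]].
  by apply: vanishing_bounded => //; [exact: V0C_continuous|exact: V0C_vanishing].
pose q (f : elt) : R := weighted_sup [set: Y] w f.
have qD f g : q (f + g) <= q f + q g.
  by rewrite /q linsub_funD; exact: weighted_supD.
have qZ k f : q (k *: f) = modulus k * q f.
  by rewrite /q linsub_funZ; exact: weighted_supZ.
pose p := Seminorm qD qZ.
have pc n : continuous (p \o V0C_incl c v n).
  move=> g; have [M wM] := wn n.
  have M0 : 0 < `|M| + 1 by rewrite ltr_wpDl.
  apply: (iffRL (@cvgrPdist_lt _ _ _ (nbhs (g : C0 c (fun _ : unit => v n))) _ _ _)).
  move=> e e0; have d0 : 0 < e / (`|M| + 1) by rewrite divr_gt0.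
  apply/nbhs_translate; apply: filterS (C0_norm_nbhs0 (fun=> v n) tt d0) => h /= hd.
  rewrite distrC (le_lt_trans (seminorm_dist p _ _))//.
  rewrite linearD/= addrC addKr.
  rewrite (@le_lt_trans _ _ (`|M| * (e / (`|M| + 1))))//.
    apply: weighted_sup_le => [|y _]; first by rewrite mulr_ge0// ltW.
    rewrite (@le_trans _ _ (`|M| * (v n y * modulus (linsub_fun h y))))//.
      rewrite mulrA ler_wpM2r ?modulus_ge0// (le_trans (wM y))//.
      by rewrite ler_wpM2r ?ler_norm// ltW// weight_gt0.
    rewrite ler_wpM2l//; apply: le_trans hd.
    exact: (@C0_norm_ub _ unit (fun=> v n) tt h y).
  by rewrite mulrCA gtr_pMr// ltr_pdivrMr// mul1r ltrDl.
exists [:: exist (fun p : seminorm elt =>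
  forall n, continuous (p \o V0C_incl c v n)) p pc], 1 => //.
move=> f; rewrite /seminormed_ball/= subr0 /seminorm_sum big_seq1 /= => f1 y.
by apply: le_trans (ltW f1); exact: (weighted_sup_ub (bounded f) (I : [set: Y] y)).
Qed.

Definition V0C_eval (k : K) (y : Y) (f : F) : K^o := k * linsub_fun f y.

Let V0C_eval_linear k y : linear (V0C_eval k y).
Proof.
move=> b f g; rewrite /V0C_eval linsub_funD linsub_funZ mulrDr.
by congr (_ + _); rewrite [LHS]mulrCA.
Qed.

HB.instance Definition _ k y := GRing.isLinear.Build K F K^o _ (V0C_eval k y)
  (V0C_eval_linear k y).

Lemma V0C_eval_continuous k y : continuous (V0C_eval k y).
Proof.
apply: functional_continuous.
have := V0C_subordinate_nbhs (subordinateZ (modulus_ge0 k)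
  (subordinate_compact v (@compact_set1 _ y))).
apply: filterS => f /(_ y) /=.
by rewrite mem_set// mulr1 modulusM.
Qed.

Definition V0C_delta k y : dual F := Dual (@V0C_eval_continuous k y).

End V0CEvaluation.
End Evaluation.

Lemma powR_split (R : realType) (theta p : R) : 0 < p ->
  p `^ theta * p `^ (1 - theta) = p.
Proof.
move=> p0; rewrite -powRD; last by apply/implyP => _; rewrite gt_eqF.
by rewrite addrC subrK powRr1// ltW.
Qed.

Section WeightConditions.
Context {R : realType} {c : scalar_kind} {X : topologicalType}.
Local Notation K := (scalars R c).
Hypotheses (Xh : hausdorff_space X) (Xl : locally_compact [set: X]).
Context (a : increasing_weights R X).
Local Notation E := (C0 c a).

Let a0 n x : 0 < a n x. Proof. exact: weight_gt0. Qed.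

(** Condition Omega is applied to the evaluations: the dual norm of the
    evaluation at x is the reciprocal of the weight at x, and it is attained
    at a bump around x divided by the weight. *)
Lemma cond_Omega_weights : cond_Omega (@C0_norms R c X nat a) ->
  forall N, exists2 M, (N <= M)%N & forall k, (M <= k)%N -> exists D theta,
    [/\ 0 < D, 0 < theta < 1 & forall x,
      (a M x)^-1 <= D * (a k x)^-1 `^ theta * (a N x)^-1 `^ (1 - theta)].
Proof.
move=> omega N; have [M NM MP] := omega N; exists M => // k Mk.
have [D [theta [D0 t01 tP]]] := MP k Mk; exists D, theta; split=> // x.
pose delta : dual E := @C0_delta R c X nat a 0%N 1 x.
have ub n : (dual_norm (C0_norms n) delta <= ((a n x)^-1)%:E)%E.
  apply: ge_ereal_sup => _ [f /= f1 <-]; rewrite lee_fin /C0_eval mul1r.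
  rewrite -(ler_pM2l (a0 n x)) mulfV ?gt_eqF//.
  by apply: le_trans f1; exact: C0_norm_ub.
have lb : (((a M x)^-1)%:E <= dual_norm (C0_norms M) delta)%E.
  have [u [uc u01 ux _ [L Lc uL]]] := @bump R X Xh Xl x setT filterT.
  pose g y : R := u y / a M y.
  have gc : continuous g by apply: continuous_div => //; exact: weight_continuous.
  pose f : X -> K^o := fun y => real_scalar (g y).
  have g0 y : 0 <= g y by rewrite divr_ge0 ?(ltW (a0 _ _))//; case/andP: (u01 y).
  have fa : C0_set a f.
    apply: C0_compact_support Lc _.
      move=> y; apply: (@continuous_comp _ _ _ g real_scalar); first exact: gc.
      exact: real_scalar_continuous.
    by move=> y /uL uy; rewrite /f /g uy mul0r real_scalar0.
  pose h : E := @linsub_elt _ _ (C0_linsub c a) f fa.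
  apply: ereal_sup_ubound; exists h => /=.
    apply: weighted_sup_le => // y _.
    rewrite /h /f /= modulus_real// mulrC mulfVK ?gt_eqF//.
    by case/andP: (u01 y).
  congr EFin; rewrite /= /C0_eval mul1r [modulus _]modulus_real//.
  by rewrite /g ux mul1r.
have t0 : 0 <= theta by case/andP: t01 => /ltW.
have t1 : 0 <= 1 - theta by case/andP: t01 => _ /ltW; rewrite subr_ge0.
rewrite -lee_fin (le_trans lb)// (le_trans (tP _))//.
have pos n : (0 <= dual_norm (C0_norms n) delta)%E.
  apply: ereal_sup_ubound; exists 0 => /=.
    by rewrite /C0_norms /C0_norm; apply: weighted_sup_le => // y _;
      rewrite modulus0 mulr0.
  by rewrite linear0 modulus0.
rewrite !EFinM -!poweR_EFin.
have mono n r : 0 <= r ->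
    ((dual_norm (C0_norms n) delta) `^ r <= ((a n x)^-1)%:E `^ r)%E.
  by move=> r0; apply: gt0_ler_poweR => //; rewrite in_itv/= ?pos ?leey//
    lee_fin invr_ge0 ltW.
apply: lee_pmul; rewrite ?poweR_ge0 ?mule_ge0 ?poweR_ge0 ?lee_fin ?(ltW D0)//;
  last exact: mono.
by apply: lee_pmul; rewrite ?poweR_ge0 ?lee_fin ?(ltW D0)//; exact: mono.
Qed.

(** Condition DN is applied to bumps around x, on whose support the two weights
    on the right are at most twice their values at x. *)
Lemma cond_DN_weights : cond_DN (@C0_norms R c X nat a) ->
  exists n, forall m theta, (n <= m)%N -> 0 < theta < 1 ->
    exists k C, 0 < C /\
      forall x, a m x <= C * a k x `^ theta * a n x `^ (1 - theta).
Proof.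
move=> [n nP]; exists n => m theta nm t01.
have [k [C [mk C0 kP]]] := nP m theta nm t01.
exists k, (C * 2); split; first exact: mulr_gt0.
move=> x; have near i : \forall y \near x, a i y <= 2 * a i x.
  move/cvgrPdist_lt : (@weight_continuous _ _ (a i) x) => /(_ _ (a0 i x)).
  by apply: filterS => y; rewrite ltr_norml => /andP[+ _]; lra.
have [u [uc u01 ux uU [L Lc uL]]] :=
  @bump R X Xh Xl x _ (filterI (near k) (near n)).
pose f : X -> K^o := fun y => real_scalar (u y).
have fa : C0_set a f.
  apply: C0_compact_support Lc _.
    move=> y; apply: (@continuous_comp _ _ _ u real_scalar); first exact: uc.
    exact: real_scalar_continuous.
  by move=> y /uL uy; rewrite /f uy real_scalar0.
pose h : E := @linsub_elt _ _ (C0_linsub c a) f fa.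
have fu y : modulus (f y) = u y by rewrite modulus_real//; case/andP: (u01 y).
have norm_le i : (forall y, ~ (a i y <= 2 * a i x) -> u y = 0) ->
    C0_norms i h <= 2 * a i x.
  move=> ui; apply: weighted_sup_le => [|y _]; first by rewrite mulr_ge0// ltW.
  rewrite [modulus _]fu; have [ay|/ui ->] := pselect (a i y <= 2 * a i x).
    apply: le_trans ay; rewrite ger_pMr//.
    by case/andP: (u01 y).
  by rewrite mulr0 mulr_ge0// ltW.
have hk : C0_norms k h <= 2 * a k x by apply: norm_le => y yk; apply: uU => -[].
have hn : C0_norms n h <= 2 * a n x by apply: norm_le => y yk; apply: uU => -[].
have h0 i : 0 <= C0_norms i h.
  apply: le_trans (@C0_norm_ub _ c _ _ a i h x).
  by rewrite mulr_ge0 ?modulus_ge0// ltW.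
have /andP[/ltW t0 /ltW t1] := t01; rewrite -subr_ge0 in t1.
have hm : a m x <= C0_norms m h.
  apply: le_trans (@C0_norm_ub _ c _ _ a m h x).
  by rewrite [modulus _]fu ux mulr1.
rewrite (le_trans hm)// (le_trans (kP h))//.
have two i : 0 <= 2 * a i x by rewrite mulr_ge0// ltW.
apply: (@le_trans _ _ (C * (2 * a k x) `^ theta * (2 * a n x) `^ (1 - theta))).
  apply: ler_pM; rewrite ?mulr_ge0 ?powR_ge0 ?(ltW C0)//.
    by rewrite ler_wpM2l ?(ltW C0)// ge0_ler_powR// nnegrE.
  by rewrite ge0_ler_powR// nnegrE.
rewrite !powRM ?(ltW (a0 _ _))//.
have := powR_split theta (ltr0n R 2 : 0 < 2).
move: (2 `^ theta) (2 `^ (1 - theta)) => p q pq.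
by rewrite -pq le_eqVlt; apply/orP; left; apply/eqP; ring.
Qed.

End WeightConditions.

Section CombinedCondition.
Context {R : realType}.

(** If s <= r t, the mean is at most a multiple of t; otherwise it is at most
    a multiple of s, and the choice of r makes the factor equal to e. *)
Lemma geometric_mean_le (theta C e : R) : 0 < theta < 1 -> 0 < C -> 0 < e ->
  exists2 S, 0 < S & forall s t : R, 0 < s -> 0 < t ->
    C * t `^ theta * s `^ (1 - theta) <= e * s + S * t.
Proof.
move=> /andP[t0 t1] C0 e0; have t1' : 0 <= 1 - theta by rewrite subr_ge0 ltW.
have tne : theta != 0 by rewrite gt_eqF.
pose r := (C / e) `^ theta^-1.
have Ce : 0 < C / e by rewrite divr_gt0.
have r0 : 0 < r by exact: powR_gt0.
have rt : r `^ theta = C / e by rewrite -powRrM mulVf// powRr1// ltW.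
exists (C * r `^ (1 - theta)); first by rewrite mulr_gt0// powR_gt0.
move=> s t s0 tpos.
have [srt|rts] := leP s (r * t).
  rewrite -[leLHS]add0r; apply: lerD; first by rewrite mulr_ge0// ltW.
  rewrite -[t in leRHS](powR_split theta)// -!mulrA ler_pM2l// mulrCA.
  rewrite ler_wpM2l ?powR_ge0// -powRM ?(ltW r0) ?(ltW tpos)//.
  by rewrite ge0_ler_powR// nnegrE ltW// mulr_gt0.
rewrite -[leLHS]addr0; apply: lerD; last by rewrite !mulr_ge0 ?powR_ge0 ?ltW.
rewrite -[s in leRHS](powR_split theta)// mulrA ler_wpM2r ?powR_ge0//.
rewrite -ler_pdivrMl// mulrA (mulrC e^-1) -rt -powRM ?(ltW r0) ?(ltW tpos)//.
by rewrite ge0_ler_powR ?nnegrE ?(ltW t0)// ltW// mulr_gt0.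
Qed.

(** Condition DN holds for every exponent, in particular for the one given by
    condition Omega; the product of the two inequalities is then a geometric
    mean of the bounds of the steps (N, n) and (k0, k). *)
Lemma combined_condition (c : scalar_kind) (X1 X2 : topologicalType)
    (Xh1 : hausdorff_space X1) (Xh2 : hausdorff_space X2)
    (Xl1 : locally_compact [set: X1]) (Xl2 : locally_compact [set: X2])
    (a : increasing_weights R X1) (b : increasing_weights R X2) :
  cond_Omega (@C0_norms R c X1 nat a) -> cond_DN (@C0_norms R c X2 nat b) ->
  exists n, forall N, exists M, forall m k0 e, 0 < e -> exists k S, 0 < S /\
    forall x y, b m y / a M x <= e * (b n y / a N x) + S * (b k y / a k0 x).
Proof.
move=> /(cond_Omega_weights Xh1 Xl1) omega /(cond_DN_weights Xh2 Xl2)[n nP].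
have a0 i x : 0 < a i x by exact: weight_gt0.
have b0 i y : 0 < b i y by exact: weight_gt0.
exists n => N; have [M NM MP] := omega N; exists M => m k0 e e0.
have [D [theta [D0 t01 DP]]] := MP (maxn k0 M) (leq_maxr _ _).
have [k [C [C0 CP]]] := nP (maxn n m) theta (leq_maxl _ _) t01.
have [S S0 SP] := geometric_mean_le t01 (mulr_gt0 C0 D0) e0.
exists k, S; split => // x y.
have q0 i l : 0 < b i y / a l x by rewrite divr_gt0.
have bm : b m y <= b (maxn n m) y by rewrite inc_weight_le// leq_maxr.
have ak : (a (maxn k0 M) x)^-1 <= (a k0 x)^-1.
  by rewrite lef_pV2 ?posrE// inc_weight_le// leq_maxl.
apply: (@le_trans _ _ (e * (b n y / a N x) + S * (b k y / a (maxn k0 M) x))).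
  apply: le_trans (SP _ _ (q0 n N) (q0 k (maxn k0 M))).
  apply: (@le_trans _ _ ((C * b k y `^ theta * b n y `^ (1 - theta)) *
    (D * (a (maxn k0 M) x)^-1 `^ theta * (a N x)^-1 `^ (1 - theta)))).
    by rewrite ler_pM ?invr_ge0 ?(ltW (b0 _ _)) ?(ltW (a0 _ _)) ?(le_trans bm).
  rewrite !powRM ?invr_ge0 ?(ltW (b0 _ _)) ?(ltW (a0 _ _))//.
  by rewrite le_eqVlt; apply/orP; left; apply/eqP; ring.
by rewrite lerD2l ler_pM2l// ler_pM2l.
Qed.

End CombinedCondition.

(** * Absolutely convex sets absorbing the Banach discs *)

Section FunctionSets.
Context {R : realType} {c : scalar_kind} {Y : topologicalType}.
Local Notation K := (scalars R c).
Context (S : linsub (Y -> K^o)).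

Definition function_set (A : set (linsub_type S)) : set (Y -> K^o) :=
  [set g | exists2 h : linsub_type S, A h & (h : Y -> K^o) = g].

Lemma function_set_in (A : set (linsub_type S)) (f : linsub_type S) :
  function_set A f -> A f.
Proof. by move=> [h Ah hf]; have <- : h = f by exact: val_inj. Qed.

Lemma function_set_absolutely_convex (A : set (linsub_type S)) :
  absolutely_convex A -> absolutely_convex (function_set A).
Proof.
move=> [A0 Ac]; split; first by exists 0.
move=> a b _ _ ab [g Ag <-] [h Ah <-].
by exists (a *: g + b *: h); [exact: Ac|rewrite linsub_funD !linsub_funZ].
Qed.

End FunctionSets.

Section ProductUltrabornological.
Context {R : realType} {c : scalar_kind} {X1 X2 : topologicalType}.
Local Notation K := (scalars R c).
Context (lc2 : locally_compact [set: X2]).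
Context (a : increasing_weights R X1) (v : decreasing_weights R X2).
Local Notation W := (nachbin_space c (product_family lc2 a v)).
Local Notation elt := (linsub_type (nachbin_linsub c (product_family lc2 a v))).

Let product_elt (g : X1 * X2 -> K^o) : nachbin_set (product_family lc2 a v) g ->
  elt := @linsub_elt _ _ (nachbin_linsub c (product_family lc2 a v)) g.

(** The bound describing the unit ball of the step (N, n). *)
Definition step_bound N n (z : X1 * X2) : R := (tensor_weight (a N) (v n) z)^-1.

Let a0 n x : 0 < a n x. Proof. exact: weight_gt0. Qed.
Let v0 n y : 0 < v n y. Proof. exact: weight_gt0. Qed.

Lemma step_bound_gt0 N n z : 0 < step_bound N n z.
Proof. by rewrite invr_gt0 tensor_weight_gt0. Qed.

Lemma step_bound_le N N' n n' z : (N' <= N)%N -> (n <= n')%N ->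
  step_bound N n z <= step_bound N' n' z.
Proof.
move=> NN nn; rewrite lef_pV2 ?posrE ?tensor_weight_gt0//.
by rewrite ler_pM ?(ltW (a0 _ _)) ?(ltW (v0 _ _))// ?inc_weight_le ?dec_weight_le.
Qed.

Lemma step_bound_continuous N n : continuous (step_bound N n).
Proof.
move=> z; apply: cvgV; first by rewrite gt_eqF// tensor_weight_gt0.
by apply: tensor_weight_continuous; exact: weight_continuous.
Qed.

Definition step_disc (k : nat -> nat) (S : nat -> R) : set elt :=
  [set f | forall N z, modulus (f z) <= S N * step_bound N (k N) z].

Lemma step_disc_banach k S : (forall N, 0 < S N) ->
  banach_disc (step_disc k S : set W).
Proof.
move=> S0; apply: (@pointwise_banach_disc R c _ (product_family lc2 a v) nat
  (fun N z => S N * step_bound N (k N) z)) => [N z|[N [w wv]]].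
  by rewrite mulr_ge0 ?(ltW (S0 N))// ltW// step_bound_gt0.
have [_ /(_ (k N))[M wM]] := wv; exists N, (S N * M) => z.
rewrite /= /product_weight/= mulrCA ler_pM2l// /step_bound ler_pdivrMr ?tensor_weight_gt0//.
by rewrite /tensor_weight mulrCA ler_pM2l.
Qed.

Lemma product_step_bounded (f : elt) N : exists n, exists2 S, 0 < S &
  forall z, modulus (f z) <= S * step_bound N n z.
Proof.
have [n [M fM]] := product_bounded f N; exists n, (`|M| + 1).
  by rewrite ltr_wpDl.
move=> z; rewrite ler_pdivlMr ?tensor_weight_gt0// mulrC (le_trans (fM z))//.
by rewrite (le_trans (ler_norm _))// lerDl.
Qed.

Context (vreg : regularly_decreasing v) (n : nat).

(** Pointwise form of a decomposition of unit balls of steps: that of (M, m) is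
    contained in a small multiple of that of (N, n) plus a multiple of that of
    (k0, k), with the same n for all N. *)
Hypothesis decomposable : forall N, exists M, forall m k0 e, 0 < e ->
  exists k S, 0 < S /\ forall z,
    step_bound M m z <= e * step_bound N n z + S * step_bound k0 k z.

Section AbsorbingSet.
Context (A : set W) (Ac : absolutely_convex A).
Hypothesis AB : forall B, banach_disc B -> absorbs A B.

Let Afun := function_set (A : set elt).
Let Afun_convex : absolutely_convex Afun.
Proof. exact: function_set_absolutely_convex. Qed.

(** Otherwise one function outside A in each of the sets, rescaled, would
    give a sequence contained in a Banach disc that A does not absorb. *)
Lemma absorbing_small_ball : exists N, exists2 d : R, 0 < d &
  forall f : elt, (forall z, modulus (f z) <= d * step_bound N n z) -> A f.
Proof.
apply/not_existsP => none.
have /choice[f fP] : forall N : nat, exists f : elt,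
    (forall z, modulus (f z) <= N.+1%:R^-1 * step_bound N n z) /\ ~ A f.
  move=> N; apply/not_existsP => Nf; apply: (none N); exists N.+1%:R^-1.
    by rewrite invr_gt0.
  by move=> f ft; apply: contrapT => Af; apply: (Nf f).
pose g N : elt := real_scalar N.+1%:R *: f N.
have gE N z : modulus (g N z) = N.+1%:R * modulus (f N z).
  by rewrite modulus_linsub_funZ modulus_real.
have gt N z : modulus (g N z) <= step_bound N n z.
  rewrite gE -ler_pdivlMl//; exact: (fP N).1.
have gk k0 : exists kS : nat * R, 0 < kS.2 /\
    forall N z, modulus (g N z) <= kS.2 * step_bound k0 kS.1 z.
  suff [k [S S0 kS]] : exists k, exists2 S, 0 < S & forall N z, (N < k0)%N ->
      modulus (g N z) <= S * step_bound k0 k z.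
    exists (maxn k n, S + 1); split=> [|N z] /=; first by rewrite ltr_wpDl// ltW.
    have [Nk|kN] := ltnP N k0.
      rewrite (le_trans (kS _ _ Nk))// ler_pM ?(ltW S0)// ?(ltW (step_bound_gt0 _ _ _))//.
        by rewrite lerDl.
      by rewrite step_bound_le// leq_maxl.
    rewrite (le_trans (gt N z))// -[leLHS]mul1r ler_pM ?(ltW (step_bound_gt0 _ _ _))//.
      by rewrite lerDr ltW.
    by rewrite step_bound_le// leq_maxr.
  elim: {1}k0 => [|p [k [S S0 kS]]]; first by exists 0%N, 1.
  have [k' [S' S'0 kS']] := product_step_bounded (g p) k0.
  exists (maxn k k'), (S + S'); first exact: addr_gt0.
  move=> N z; rewrite ltnS leq_eqVlt => /predU1P[->|/kS Nk].
    rewrite (le_trans (kS' z))// ler_pM ?(ltW S'0) ?(ltW (step_bound_gt0 _ _ _))//.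
      by rewrite lerDr ltW.
    by rewrite step_bound_le// leq_maxr.
  rewrite (le_trans (Nk z))// ler_pM ?(ltW S0) ?(ltW (step_bound_gt0 _ _ _))//.
    by rewrite lerDl ltW.
  by rewrite step_bound_le// leq_maxl.
have {}/choice[kS kSP] := gk.
have kS0 N : 0 < (kS N).2 by have [] := kSP N.
have [r r0 rP] := AB (step_disc_banach (fun N => (kS N).1) kS0).
pose N := Num.bound r.
have N0 : 0 < N.+1%:R :> R by rewrite ltr0n.
have [|h Ah hg] := rP (real_scalar N.+1%:R) _ (g N) (fun k0 z => (kSP k0).2 N z).
  rewrite modulus_real// (le_trans (ltW (archi_boundP (ltW r0))))//.
  by rewrite ler_nat.
apply: (fP N).2; have -> : f N = h; last by [].
have N1 := @real_scalar_neq0 _ c _ N0.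
exact: (@scalerI K W _ N1).
Qed.

(** A function of the unit ball of the step (M, m) is truncated at a small
    multiple of the bound of the step (N, n). The truncated part is in A / 2;
    the remainder does not depend on k0, and so satisfies the bounds of the
    decomposition for all k0 at once, which place it in a Banach disc. *)
Lemma absorbing_steps : exists M, forall m, exists2 e : R, 0 < e &
  forall f : elt, (forall z, modulus (f z) <= e * step_bound M m z) -> A f.
Proof.
have [N [d d0 dP]] := absorbing_small_ball.
have [M MP] := decomposable N; exists M => m.
have d2 : 0 < d / 2 by rewrite divr_gt0.
have /choice[kS kSP] : forall k0, exists kS : nat * R, 0 < kS.2 /\ forall z,
    step_bound M m z <= d / 2 * step_bound N n z + kS.2 * step_bound k0 kS.1 z.
  by move=> k0; have [k [S kP]] := MP m k0 _ d2; exists (k, S).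
have kS0 k0 : 0 < (kS k0).2 by have [] := kSP k0.
have [r r0 rP] := AB (step_disc_banach (fun k0 => (kS k0).1) kS0).
have r2 : 0 < 2^-1 + r by rewrite addr_gt0// invr_gt0.
exists (2^-1 + r)^-1; first by rewrite invr_gt0.
move=> f ft.
pose T z := d / 2 * step_bound N n z.
have T0 z : 0 < T z by rewrite mulr_gt0// step_bound_gt0.
have Tc : continuous T.
  by move=> z; apply: cvgM; [exact: cvg_cst|exact: step_bound_continuous].
pose e := (2^-1 + r)^-1; have e0 : 0 < e by rewrite invr_gt0.
pose f' : elt := real_scalar e^-1 *: f.
have f't z : modulus (f' z) <= step_bound M m z.
  have ie0 : 0 < e^-1 by rewrite invr_gt0.
  rewrite modulus_linsub_funZ modulus_real ?(ltW ie0)//.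
  by rewrite ler_pdivrMl// ft.
have fc' : continuous (f' : _ -> K^o) := (linsub_in f').1.
pose u := truncation T f'.
have u01 z : 0 <= u z <= 1 by exact: truncation01.
have uc : continuous u by exact: truncation_continuous.
have uc' : continuous (fun z => 1 - u z).
  by move=> z; apply: cvgB; [exact: cvg_cst|exact: uc].
have u01' z : 0 <= 1 - u z <= 1 by move: (u01 z); lra.
pose g : elt := product_elt (nachbin_rescale f' uc u01).
pose h : elt := product_elt (nachbin_rescale f' uc' u01').
have uf z : u z * modulus (f' z) = Num.min (T z) (modulus (f' z)).
  exact: truncation_modulus.
have Ag : A (real_scalar 2 *: g).
  apply: dP => z; rewrite modulus_linsub_funZ modulus_real//.
  rewrite [modulus _]modulus_rescale; last by case/andP: (u01 z).
  rewrite uf -ler_pdivlMl// mulrA (mulrC 2^-1) -/(T z).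
  by rewrite ge_min lexx.
have hP : step_disc (fun k0 => (kS k0).1) (fun k0 => (kS k0).2) h.
  move=> k0 z; rewrite [modulus _]modulus_rescale; last by case/andP: (u01' z).
  rewrite mulrBl mul1r uf; have [_ /(_ z) kz] := kSP k0.
  have := f't z; have := mulr_ge0 (ltW (kS0 k0)) (ltW (step_bound_gt0 k0 (kS k0).1 z)).
  move: kz; rewrite -/(T z).
  case: (leP (T z) (modulus (f' z))) => h1; lra.
have [|h' Ah' hh'] := rP (real_scalar r) _ h hP; first by rewrite modulus_real// ltW.
have -> : f = real_scalar (e / 2) *: (real_scalar 2 *: g) + real_scalar (e * r) *: h'.
  have -> : f = real_scalar e *: f'.
    by rewrite scalerA -real_scalarM mulfV ?gt_eqF// real_scalar1 scale1r.
  have -> : f' = g + h.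
    apply: val_inj; apply/funext => z.
    transitivity (real_scalar (u z) * f' z + real_scalar (1 - u z) * f' z) => //.
    by rewrite -mulrDl -real_scalarD addrC subrK real_scalar1 mul1r.
  rewrite scalerDr scalerA -real_scalarM mulfVK// -hh'.
  by rewrite [in RHS]real_scalarM -scalerA.
have e2 : 0 <= e / 2 by rewrite divr_ge0// ltW.
have er : 0 <= e * r by rewrite mulr_ge0// ltW.
apply: Ac.2 => //; rewrite !modulus_real//.
by rewrite -mulrDr mulVf// gt_eqF.
Qed.

(** With w the infimum of suitable multiples of the v m, a function bounded by
    the reciprocal of 2 w times the weight of index M is cut into slices lying
    in the multiples of unit balls of steps that A contains. *)
Lemma absorbing_nbhs : nbhs (0 : W) A.
Proof.
have [M] := absorbing_steps.
move=> MP; have {MP}/choice[e eP] : forall m, exists e : R, 0 < e /\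
    forall f : elt, (forall z, modulus (f z) <= e * step_bound M m z) -> A f.
  by move=> m; have [e e0 eP] := MP m; exists e.
have e0 m : 0 < e m by have [] := eP m.
pose q m : R := 2^-1 ^+ m.+2 * e m.
have q0 m : 0 < q m by rewrite mulr_gt0// exprn_gt0// invr_gt0.
have C0 m : 0 < (q m)^-1 by rewrite invr_gt0.
have [w [wv le_w]] := subordinate_inf v C0.
have wv2 : subordinate v (fun y => 2 * w y) by exact: subordinateZ.
apply/nachbin_nbhs0P; exists (M, exist _ _ wv2) => f fw.
apply: function_set_in.
pose t m z := q m * step_bound M m z.
have t0 m z : 0 < t m z by rewrite mulr_gt0// step_bound_gt0.
have tc m : continuous (t m).
  by move=> z; apply: cvgM; [exact: cvg_cst|exact: step_bound_continuous].
have [m0 fm0] := product_step f M vreg.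
have [L Lc Lf] := fm0 _ (q0 m0).
(* The step containing f comes first and takes f at infinity. *)
pose t' i := if i is k.+1 then t k else t m0.
apply: (slice_decomposition (t := t') (L := L)) => //.
- by move=> [|i] z; exact: t0.
- by move=> [|i]; exact: tc.
- exact: (linsub_in f).1.
- move=> z /Lf /ltW fz.
  by rewrite /t' /t ler_pdivlMr ?tensor_weight_gt0// mulrC.
- move=> z _; have := fw z.
  rewrite /= /product_weight /tensor_weight /= => fz.
  have [||m fm] := @subordinate_inf_lt _ _ v _ w z.2 (a M z.1 * modulus (f z)) C0 (le_w z.2).
  + by rewrite mulr_ge0 ?modulus_ge0// ltW.
  + rewrite mulrA (mulrC (w _)).
    have : a M z.1 * (2 * w z.2) * modulus (f z) = 2 * (a M z.1 * w z.2 * modulus (f z)).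
      by ring.
    move=> E; rewrite E in fz; move: fz; lra.
  exists m.+1; rewrite /t' /t /step_bound /tensor_weight.
  move: fm; rewrite invfM invrK => fm.
  by rewrite invfM mulrCA -ltr_pdivrMl ?invr_gt0// invrK.
move=> i u uc u01 ut _.
have bnd m k : (k <= m.+2)%N -> (forall z, u z * modulus (f z) <= t m z) ->
    Afun (real_scalar (2 ^+ k) *: rescale u f).
  move=> km um.
  pose g : elt := product_elt (nachbin_rescale f uc u01).
  exists (real_scalar (2 ^+ k) *: g); last by rewrite linsub_funZ.
  apply: (eP m).2 => z; rewrite modulus_linsub_funZ.
  rewrite modulus_real ?exprn_ge0//.
  rewrite [X in _ * X]modulus_rescale; last by case/andP: (u01 z).
  apply: (@le_trans _ _ (2 ^+ k * t m z)); first by rewrite ler_wpM2l// exprn_ge0.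
  rewrite /t mulrA ler_pM2r ?step_bound_gt0// /q mulrA.
  by rewrite ger_pMl; [exact: dyadic_le1|exact: e0].
by case: i ut => [|i] ut; [apply: (bnd m0)|apply: (bnd i)].
Qed.

End AbsorbingSet.

Theorem product_ultrabornological : ultrabornological W.
Proof. by move=> A Ac AB; exact: absorbing_nbhs. Qed.

End ProductUltrabornological.

(** * The injective tensor product inside the function space *)

Section PolarBound.
Context {R : realType} {c : scalar_kind}.
Local Notation K := (scalars R c).

(** By homogeneity, x divided by any number above r lies in U. *)
Lemma polar_le (E : tvsType K) (I : Type) (p : I -> E -> R) (U : set E)
    (phi : dual E) x (r : R) :
  (forall i k x, p i (k *: x) = modulus k * p i x) ->
  (forall x, (forall i, p i x <= 1) -> U x) -> polar U phi -> 0 <= r ->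
  (forall i, p i x <= r) -> modulus (phi x) <= r.
Proof.
move=> pZ pU Uphi r0 xr; apply/ler_addgt0Pr => e e0.
have re : 0 < r + e by rewrite ltr_wpDl.
have ire : 0 <= (r + e)^-1 by rewrite invr_ge0 ltW.
have : modulus (phi (real_scalar (r + e)^-1 *: x)) <= 1.
  apply/Uphi/pU => i; rewrite pZ modulus_real// ler_pdivrMl// mulr1.
  by rewrite (le_trans (xr i))// lerDl ltW.
rewrite linearZ /= [modulus _]modulusM modulus_real//.
by rewrite ler_pdivrMl// mulr1.
Qed.

End PolarBound.

Section TensorEmbedding.
Context {R : realType} {c : scalar_kind} {X1 X2 : topologicalType}.
Local Notation K := (scalars R c).
Context (lc2 : locally_compact [set: X2]).
Context (a : increasing_weights R X1) (v : decreasing_weights R X2).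
Local Notation E := (C0 c a).
Local Notation F := (V0C c v).
Local Notation H := (injective_tensor E F).
Local Notation W := (nachbin_space c (product_family lc2 a v)).
Local Notation elt := (linsub_type (nachbin_linsub c (product_family lc2 a v))).
Local Notation tensor := (linsub_type (@tensor_linsub R c E F)).

Let a0 n x : 0 < a n x. Proof. exact: weight_gt0. Qed.
Let v0 n y : 0 < v n y. Proof. exact: weight_gt0. Qed.

Definition tensor_fun (u : dual E * dual F -> K^o) (z : X1 * X2) : K^o :=
  u (C0_delta a 0%N 1 z.1, V0C_delta v 1 z.2).

Lemma tensor_fun_sum s z :
  tensor_fun (tensor_sum s) z = \sum_(t <- s) linsub_fun t.1 z.1 * linsub_fun t.2 z.2.
Proof.
by rewrite /tensor_fun /tensor_sum; apply: eq_bigr => t _ /=;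
  rewrite /C0_eval /V0C_eval !mul1r.
Qed.

Lemma tensor_sum_delta s k l x y :
  tensor_sum s (C0_delta a 0%N k x, V0C_delta v l y) =
  k * l * tensor_fun (tensor_sum s) (x, y).
Proof.
rewrite tensor_fun_sum /tensor_sum mulr_sumr; apply: eq_bigr => t _ /=.
by rewrite /C0_eval /V0C_eval mulrACA.
Qed.

(** Both factors are bounded, so that it is enough that one of them be small. *)
Lemma elementary_tensor_vanishing (f : linsub_type (C0_linsub c a))
    (g : linsub_type (V0C_linsub c v)) N w : subordinate v w ->
  vanishing (tensor_weight (a N) w) (fun z : X1 * X2 => f z.1 * g z.2 : K^o).
Proof.
move=> wv e e0; have [w0 wn] := wv.
have [fc fa] := linsub_in f.
have [M fM] := C0_bounded N (linsub_in f).
have gw := V0C_vanishing g wv.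
have [M' gM] : exists M', forall y, w y * modulus (g y) <= M'.
  have [n gn] := linsub_in g; have [B wB] := wn n.
  have [B' gB] := C0_bounded tt gn.
  exists (`|B| * B') => y; apply: (@le_trans _ _ (`|B| * (v n y * modulus (g y)))).
    rewrite mulrA ler_wpM2r ?modulus_ge0// (le_trans (wB y))//.
    by rewrite ler_wpM2r ?ler_norm// ltW.
  by rewrite ler_wpM2l//; apply: gB; exists y.
have M0 : 0 < `|M| + 1 by rewrite ltr_wpDl.
have M'0 : 0 < `|M'| + 1 by rewrite ltr_wpDl.
have [|L Lc Lf] := fa N (e / (`|M'| + 1)); first by rewrite divr_gt0.
have [|L' L'c Lg] := gw (e / (`|M| + 1)); first by rewrite divr_gt0.
exists (L `*` L'); first exact: compact_setX.
move=> [x y] /=; rewrite /tensor_weight/= modulusM mulrACA => xy.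
have f0 : 0 <= a N x * modulus (f x) by rewrite mulr_ge0 ?modulus_ge0// ltW.
have g0 : 0 <= w y * modulus (g y) by rewrite mulr_ge0 ?modulus_ge0.
have fx : a N x * modulus (f x) <= `|M| + 1.
  rewrite (@le_trans _ _ M)//; first by apply: fM; exists x.
  by rewrite (le_trans (ler_norm _))// lerDl.
have gy : w y * modulus (g y) <= `|M'| + 1.
  by rewrite (le_trans (gM y))// (le_trans (ler_norm _))// lerDl.
have [Lx|/Lf] := pselect (L x).
  have /Lg : ~ L' y by move=> Ly; apply: xy.
  rewrite ltr_pdivlMr// mulrC => /(le_lt_trans _); apply.
  by rewrite ler_wpM2r.
rewrite ger0_norm// ltr_pdivlMr// => /(le_lt_trans _); apply.
by rewrite ler_wpM2l.
Qed.

Lemma tensor_fun_in (u : tensor) :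
  nachbin_set (product_family lc2 a v) (tensor_fun (u : _ -> K^o)).
Proof.
have [s _ us] := linsub_in u.
have -> : tensor_fun (u : _ -> K^o) =
    (fun z => \sum_(t <- s) linsub_fun t.1 z.1 * linsub_fun t.2 z.2).
  by apply/funext => z; rewrite -tensor_fun_sum us.
elim: s {us} => [|t s IH].
  under eq_fun do rewrite big_nil.
  exact: nachbin_set0.
set h : X1 * X2 -> K^o := fun z => \sum_(p <- s) _ in IH.
have -> : (fun z : X1 * X2 =>
      \sum_(p <- t :: s) linsub_fun p.1 z.1 * linsub_fun p.2 z.2) =
    1 *: (fun z => linsub_fun t.1 z.1 * linsub_fun t.2 z.2 : K^o) + h :> (_ -> K^o).
  by apply/funext => z; rewrite big_cons scale1r.
apply: nachbin_set_closed => //; split=> [z|[N [w wv]]].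
  apply: (@cvgM K _ (nbhs z)).
    by apply: (@continuous_comp _ _ _ fst (linsub_fun t.1));
      [exact: cvg_fst|exact: (linsub_in t.1).1].
  by apply: (@continuous_comp _ _ _ snd (linsub_fun t.2));
    [exact: cvg_snd|exact: V0C_continuous].
exact: elementary_tensor_vanishing.
Qed.

Definition tensor_embedding (u : H) : W :=
  @linsub_elt _ _ (nachbin_linsub c (product_family lc2 a v)) _ (tensor_fun_in u).

Let tensor_embedding_linear : linear tensor_embedding.
Proof. by move=> k f g; apply: val_inj. Qed.

HB.instance Definition _ := GRing.isLinear.Build K H W _ tensor_embedding
  tensor_embedding_linear.

Lemma sum_weights_le (s : seq nat) : exists N, forall x,
  \sum_(i <- s) a i x <= (size s)%:R * a N x.
Proof.
elim: s => [|i s [N sN]]; first by exists 0%N => x; rewrite big_nil mul0r.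
exists (maxn i N) => x; rewrite big_cons /= -natr1 mulrDl mul1r addrC.
apply: lerD; last by rewrite inc_weight_le// leq_maxl.
by rewrite (le_trans (sN x))// ler_wpM2l// inc_weight_le// leq_maxr.
Qed.

(** For fixed psi in the polar of V, the functional phi is applied to the
    function sending x to the value of psi at the section of u at x. *)
Lemma eps_norm_le (U : set E) (V : set F) : nbhs 0 U -> nbhs 0 V ->
  exists i : nat * {w : X2 -> R | subordinate v w}, forall (u : tensor) (r : R),
    0 <= r ->
    (forall z, product_weight a i z * modulus (tensor_fun (u : _ -> K^o) z) <= r) ->
    eps_norm U V (u : _ -> K^o) <= r.
Proof.
move=> /C0_nbhs0[s [d d0 sU]] /V0C_nbhs0[w wv wV].
have [N sN] := sum_weights_le s.
pose M := ((size s)%:R + 1) / d.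
have M0 : 0 < M by rewrite divr_gt0// ltr_wpDl.
have MU (f : E) : (forall x, M * a N x * modulus (linsub_fun f x) <= 1) -> U f.
  move=> fM; apply: sU => x; rewrite -(ler_pM2r M0).
  have -> : d * M = (size s)%:R + 1 by rewrite /M mulrC mulfVK ?gt_eqF.
  apply: (@le_trans _ _ ((size s)%:R * a N x * modulus (linsub_fun f x) * M)).
    by rewrite ler_wpM2r ?(ltW M0)// ler_wpM2r ?modulus_ge0.
  have -> : (size s)%:R * a N x * modulus (linsub_fun f x) * M =
      (size s)%:R * (M * a N x * modulus (linsub_fun f x)) by ring.
  by rewrite (le_trans (ler_wpM2l _ (fM x)))// mulr1 lerDl.
clearbody M; have wMv := subordinateZ (ltW M0) wv.
exists (N, exist _ _ wMv) => u r r0 ur.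
apply: weighted_sup_le => // -[phi psi] [/= Uphi Vpsi]; rewrite mul1r.
have [t _ ut] := linsub_in u.
have uE : (u : _ -> K^o) = tensor_sum t by rewrite ut.
rewrite uE /tensor_sum /=.
have -> : \sum_(p <- t) phi p.1 * psi p.2 = phi (\sum_(p <- t) psi p.2 *: p.1).
  by rewrite linear_sum; apply: eq_bigr => p _; rewrite linearZ /= mulrC.
apply: (@polar_le R c E X1 (fun x f => M * a N x * modulus (linsub_fun f x)) U) => //.
- by move=> x k f; rewrite modulus_linsub_funZ mulrCA.
move=> x.
have Ma : 0 < M * a N x by rewrite mulr_gt0.
rewrite -ler_pdivlMl//.
have -> : linsub_fun (\sum_(p <- t) psi p.2 *: p.1 : E) x =
    psi (\sum_(p <- t) linsub_fun p.1 x *: p.2).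
  transitivity (C0_eval 1 x (\sum_(p <- t) psi p.2 *: p.1)).
    by rewrite /C0_eval mul1r.
  rewrite !linear_sum; apply: eq_bigr => p _.
  transitivity (psi p.2 * C0_eval 1 x p.1); first exact: linearZ.
  by rewrite [RHS]linearZ /C0_eval mul1r [LHS]mulrC.
apply: (@polar_le R c F X2 (fun y g => w y * modulus (linsub_fun g y)) V) => //.
- by move=> y k g; rewrite modulus_linsub_funZ mulrCA.
- by rewrite mulr_ge0// invr_ge0 ltW.
move=> y; rewrite ler_pdivlMl//.
have -> : linsub_fun (\sum_(p <- t) linsub_fun p.1 x *: p.2 : F) y =
    tensor_fun (u : _ -> K^o) (x, y).
  transitivity (V0C_eval 1 y (\sum_(p <- t) linsub_fun p.1 x *: p.2)).
    by rewrite /V0C_eval mul1r.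
  rewrite uE tensor_fun_sum linear_sum; apply: eq_bigr => p _.
  by rewrite linearZ /= /V0C_eval mul1r.
apply: le_trans (ur (x, y)).
rewrite /product_weight /tensor_weight /= !mulrA.
by rewrite (mulrC M).
Qed.

Lemma tensor_embedding_nbhs (W0 : set H) : nbhs 0 W0 <->
  exists2 U, nbhs (0 : W) U & tensor_embedding @^-1` U `<=` W0.
Proof.
split=> [[s [e e0 sW]]|[U /nachbin_nbhs0P[[N [w wv]] iU] UW]].
  suff [i iP] : exists i : nat * {w : X2 -> R | subordinate v w}, forall u : tensor,
      (forall z, product_weight a i z * modulus (tensor_fun (u : _ -> K^o) z) <= 1) ->
      seminorm_sum (fun UV : {U : set E | nbhs 0 U} * {V : set F | nbhs 0 V} =>
        eps_seminorm (svalP UV.1) (svalP UV.2)) s u < e.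
    exists [set f : elt | forall z, product_weight a i z * modulus (f z) <= 1].
      by apply/nachbin_nbhs0P; exists i.
    by move=> u ui; apply: sW; rewrite /seminormed_ball/= subr0; exact: iP.
  elim: s e e0 {sW} => [|UV s IH] e e0.
    exists (nachbin_point (product_family lc2 a v)) => u _.
    by rewrite /seminorm_sum big_nil.
  have e2 : 0 < e / 2 by rewrite divr_gt0.
  have [i iP] := IH _ e2.
  have [k kP] := eps_norm_le (svalP UV.1) (svalP UV.2).
  have [l lP] := @nachbin_directed _ _ (product_family lc2 a v) k i (e / 2)^-1.
  exists l => u ul; rewrite /seminorm_sum big_cons (splitr e).
  apply: ler_ltD; last first.
    apply: iP => z; apply: le_trans (ul z).
    by rewrite ler_wpM2r ?modulus_ge0//; have [] := lP z.
  apply: kP => [|z]; first exact: ltW.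
  rewrite -[leRHS]mulr1 -ler_pdivrMl// mulrA (le_trans _ (ul z))//.
  by rewrite ler_wpM2r ?modulus_ge0//; have [] := lP z.
(* The evaluations multiplied by the weights are in the polars. *)
have UE := C0_norm_nbhs0 (c := c) a N ltr01.
have VF := V0C_subordinate_nbhs (c := c) wv.
exists [:: (exist _ _ UE, exist _ _ VF)], 1 => // u.
rewrite /seminormed_ball/= subr0 /seminorm_sum big_seq1 /= => u1.
apply/UW/iU => -[x y]; apply: le_trans (ltW u1).
have [w0 _] := wv.
pose phi := C0_delta a 0%N (real_scalar (a N x) : K) x.
pose psi := V0C_delta v (real_scalar (w y) : K) y.
have phiU : polar [set f : E | C0_norms N f <= 1] phi.
  move=> f /= f1; rewrite /C0_eval modulusM modulus_real ?(ltW (a0 _ _))//.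
  by apply: le_trans f1; exact: C0_norm_ub.
have psiV : polar ([set g : linsub_type (V0C_linsub c v) |
    forall y, w y * modulus (g y) <= 1] : set F) psi.
  by move=> g /(_ y) /= g1; rewrite /V0C_eval modulusM modulus_real.
have := @weighted_sup_ub R c _ _ (fun=> 1) _ (phi, psi)
  (eps_bounded (linsub_in u) UE VF) (conj phiU psiV).
rewrite mul1r; apply: le_trans.
have [t _ ut] := linsub_in u.
rewrite -[linsub_val u]ut tensor_sum_delta -real_scalarM modulusM.
rewrite modulus_real; last by rewrite mulr_ge0// ltW.
by rewrite /tensor_embedding /= /linsub_fun /= -ut.
Qed.

(** Near a compact set, f is approximated by freezing its first variable at
    the points of a partition of unity fine enough for f to vary little on
    the support of each of its members, uniformly in the second variable. *)
Lemma tensor_embedding_dense (hausdorff1 : hausdorff_space X1)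
    (hausdorff2 : hausdorff_space X2) (lc1 : locally_compact [set: X1])
    (f : elt) (U : set W) : nbhs (0 : W) U ->
  exists u, U (tensor_embedding u - f).
Proof.
move=> /nachbin_nbhs0P[[N [w wv]] iU].
have [fc _] := linsub_in f; have [w0 /(_ 0%N)[M wM]] := wv.
have M0 : 0 < `|M| + 1 by rewrite ltr_wpDl.
have h0 : 0 < 2^-1 :> R by rewrite invr_gt0.
have [L Lc Lf] := product_vanishing f N wv h0.
have L1c : compact (fst @` L).
  by apply: continuous_compact Lc; apply: continuous_subspaceT => z; exact: cvg_fst.
have L2c : compact (snd @` L).
  by apply: continuous_compact Lc; apply: continuous_subspaceT => z; exact: cvg_snd.
have [beta [bc b01 b1 [L' L'c bL]]] := plateau hausdorff2 lc2 (R := R) L2c.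
pose close (x0 x : X1) := forall y, L' y ->
  a N x * v 0%N y * modulus (f (x, y) - f (x0, y)) <= 2^-1 / (`|M| + 1).
have closeP x0 : nbhs x0 (close x0).
  have e0 : 0 < 2^-1 / (`|M| + 1) by rewrite divr_gt0.
  pose h (z : X1 * X2) :=
    tensor_weight (a N) (v 0%N) z * modulus (f z - f (x0, z.2)).
  have hc : continuous h.
    move=> z; apply: cvgM.
      by apply: tensor_weight_continuous; exact: weight_continuous.
    apply: (@continuous_comp _ _ _ (fun z => f z - f (x0, z.2) : K^o) (@modulus R c));
      last exact: modulus_continuous.
    apply: (@cvgB K K^o _ (nbhs z)); first exact: fc.
    apply: (@continuous_comp _ _ _ (fun z : X1 * X2 => (x0, z.2)) (linsub_fun f));
      last exact: fc.
    by apply: cvg_pair; [exact: cvg_cst|exact: cvg_snd].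
  have /compact_near_coveringP := L'c.
  apply => y _; move/cvgrPdist_lt : (hc (x0, y)) => /(_ _ e0)[[A B] [/= A0 B0] AB].
  exists (B, A) => // -[y' x] [/= By' Ax].
  have /= := AB (x, y') (conj Ax By').
  rewrite {1}/h /= subrr modulus0 mulr0 sub0r normrN => /ltW.
  by apply: le_trans; exact: ler_norm.
have [s [alpha [ac al0 alP al1 alL]]] :=
  @partition_of_unity R X1 hausdorff1 lc1 _ close L1c closeP.
have alphaE z : C0_set a (fun x => real_scalar (alpha z x) : K^o).
  have [_ [B Bc aB]] := alP z; apply: C0_compact_support Bc _.
    move=> x; apply: (@continuous_comp _ _ _ (alpha z) real_scalar); first exact: ac.
    exact: real_scalar_continuous.
  by move=> x /aB ->; rewrite real_scalar0.
have sectionF z : V0C_set v (rescale beta (fun y => f (z, y))).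
  exists 0%N; apply: C0_compact_support L'c _.
    apply: rescale_continuous => // y.
    apply: (@continuous_comp _ _ _ (fun y => (z, y)) (linsub_fun f)); last exact: fc.
    by apply: cvg_pair; [exact: cvg_cst|exact: cvg_id].
  by move=> y /bL by0; rewrite /rescale by0 real_scalar0 mul0r.
pose e z : E := @linsub_elt _ _ (C0_linsub c a) _ (alphaE z).
pose g z : F := @linsub_elt _ _ (V0C_linsub c v) _ (sectionF z).
pose t := [seq (e z, g z) | z <- s].
have tu : tensor_set (tensor_sum t) by exists t.
exists (@linsub_elt _ _ (tensor_linsub E F) _ tu); apply: iU => -[x y].
rewrite /= /product_weight /tensor_weight /=.
rewrite -[X in modulus X]/(tensor_fun (tensor_sum t) (x, y) - f (x, y) : K).
(* The first term compares f with its frozen values on the support of beta; the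
   second one vanishes on L. *)
have -> : tensor_fun (tensor_sum t) (x, y) - f (x, y) =
    real_scalar (beta y) *
      \sum_(z <- s) real_scalar (alpha z x) * (f (z, y) - f (x, y)) -
    real_scalar (1 - beta y * \sum_(z <- s) alpha z x) * f (x, y).
  rewrite tensor_fun_sum big_map /=.
  rewrite real_scalarD real_scalarN real_scalarM real_scalar1 real_scalar_sum.
  have algebra (k f0 : K) (A B : X1 -> K) :
      \sum_(z <- s) A z * (k * B z) - f0 =
      k * \sum_(z <- s) A z * (B z - f0) - (1 - k * \sum_(z <- s) A z) * f0.
    under [X in _ = _ * X - _]eq_bigr do rewrite mulrBr.
    rewrite sumrB -mulr_suml.
    have -> : \sum_(z <- s) A z * (k * B z) = k * \sum_(z <- s) A z * B z.
      by rewrite mulr_sumr; apply: eq_bigr => z _; rewrite mulrCA.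
    ring.
  exact: algebra.
have bp : 0 <= beta y <= 1 by exact: b01.
set S := \sum_(z <- s) alpha z x.
have S0 : 0 <= S by rewrite sumr_ge0.
have wa : 0 <= a N x * w y by rewrite mulr_ge0// ltW.
have bS : 0 <= 1 - beta y * S <= 1.
  have /andP[bp0 bp1] := bp.
  have bS0 : 0 <= beta y * S by exact: mulr_ge0.
  have bS1 : beta y * S <= 1 by apply: mulr_ile1 => //; exact: al1.
  lra.
rewrite (le_trans (ler_wpM2l wa (modulusD _ _)))// mulrDr modulusN.
rewrite [leRHS](_ : 1 = 2^-1 + 2^-1); last by lra.
apply: lerD.
  have [L'y|/bL ->] := pselect (L' y); last first.
    by rewrite real_scalar0 mul0r modulus0 mulr0 ltW.
  have /andP[bp0 bp1] := bp.
  have term z : alpha z x * (a N x * w y * modulus (f (z, y) - f (x, y))) <=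
      alpha z x * 2^-1.
    have [zx|zx] := pselect (close z x); last first.
      by have [/(_ _ zx) -> _] := alP z; rewrite !mul0r.
    rewrite ler_wpM2l// modulusB_sym.
    apply: (@le_trans _ _ (`|M| * (2^-1 / (`|M| + 1)))).
      apply: le_trans (ler_wpM2l _ (zx y L'y)) => //.
      rewrite !mulrA ler_wpM2r ?modulus_ge0// [leRHS]mulrAC [leRHS]mulrC.
      rewrite ler_wpM2l ?(ltW (a0 _ _))// (le_trans (wM y))//.
      by rewrite ler_wpM2r ?ler_norm// ltW.
    by rewrite mulrCA ger_pMr// ler_pdivrMr// mul1r lerDl.
  rewrite modulusM modulus_real// mulrCA.
  apply: (@le_trans _ _ (a N x * w y * \sum_(z <- s)
      modulus (real_scalar (alpha z x) * (f (z, y) - f (x, y))))).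
    rewrite (@le_trans _ _ (1 * (a N x * w y *
      modulus (\sum_(z <- s) real_scalar (alpha z x) * (f (z, y) - f (x, y))))))//.
      by rewrite ler_wpM2r// mulr_ge0 ?modulus_ge0.
    by rewrite mul1r ler_wpM2l// modulus_sum.
  rewrite mulr_sumr (@le_trans _ _ (\sum_(z <- s) alpha z x * 2^-1))//.
    apply: ler_sum => z _; apply: le_trans (term z).
    by rewrite modulusM modulus_real// mulrCA.
  by rewrite -mulr_suml ler_piMl// ltW.
have [xyL|/Lf/ltW] := pselect (L (x, y)).
  have -> : S = 1 by apply: alL; exists (x, y).
  rewrite b1; last by exists (x, y).
  by rewrite mulr1 subrr real_scalar0 mul0r modulus0 mulr0 ltW.
rewrite /tensor_weight /= modulusM modulus_real; last by case/andP: bS.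
apply: le_trans; rewrite mulrCA ler_piMl//; last by case/andP: bS.
by rewrite mulr_ge0 ?modulus_ge0.
Qed.

End TensorEmbedding.

Theorem theorem11 (R : realType) (c : scalar_kind) (X1 X2 : topologicalType)
  (hausdorff1 : hausdorff_space X1) (hausdorff2 : hausdorff_space X2)
  (lc1 : locally_compact [set: X1]) (lc2 : locally_compact [set: X2])
  (sc1 : sigma_compact X1) (sc2 : sigma_compact X2)
  (A1 : increasing_weights R X1) (A2 : increasing_weights R X2)
  (regdec : regularly_decreasing (inverse_weights A2))
  (omega : cond_Omega (@C0_norms R c X1 nat A1))
  (dn : cond_DN (@C0_norms R c X2 nat A2))
  (G : tvsType (scalars R c))
  (j : {linear injective_tensor (C0 c A1) (V0C c (inverse_weights A2)) -> G})
  (completion : is_completion j) :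
  ultrabornological G.
Proof.
have [n nP] := combined_condition hausdorff1 hausdorff2 lc1 lc2 omega dn.
have iW : completes (@tensor_embedding R c X1 X2 lc2 A1 (inverse_weights A2)).
  split.
  - exact: nachbin_separated.
  - exact: nachbin_complete.
  - exact: tensor_embedding_nbhs.
  - exact: tensor_embedding_dense.
have [f [g fg]] := completes_unique iW (completion_completes completion).
apply: (iso_ultrabornological fg).
apply: (product_ultrabornological regdec (n := n)) => N.
have [M MP] := nP N; exists M => m k0 e e0.
have [k [S [S0 SP]]] := MP m k0 e e0; exists k, S; split=> // z.
have boundE l i : step_bound A1 (inverse_weights A2) l i z = A2 i z.2 / A1 l z.1.
  by rewrite /step_bound /tensor_weight /= invfM invrK mulrC.
by rewrite !boundE.
Qed.
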